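(* Let $G$ be a connected bridgeless graph and let $D$ be a dominating set of $G$ with $|D|=\gamma$. Then $\overrightarrow{diam}(G)\le \left\lceil \frac{7\gamma+1}{2}\right\rceil$. Moreover, this bound is sharp: for every positive integer $\gamma$ there is a connected bridgeless graph $G$ with domination number $\gamma$ and $\overrightarrow{diam}(G)=\left\lceil \frac{7\gamma+1}{2}\right\rceil$.
   Context: Graphs are finite, simple, undirected and connected. A bridge is an edge whose removal disconnects the graph; a graph is bridgeless if it has no bridge. A dominating set $D$ of $G$ is a vertex set such that every vertex not in $D$ is adjacent to some vertex of $D$; the domination number is the minimum size of a dominating set. An orientation $\overrightarrow{G}$ of $G$ assigns a direction to each edge; it is strong if for all vertices $u,v$ there is a directed path from $u$ to $v$. For a strong orientation, $\partial(u,v)$ denotes the length of a shortest directed path from $u$ to $v$, $\theta(u,v)=\max\{\partial(u,v),\partial(v,u)\}$, and $diam(\overrightarrow{G})=\max_{u,v}\theta(u,v)$. The oriented diameter $\overrightarrow{diam}(G)$ of a bridgeless graph $G$ is the minimum of $diam(\overrightarrow{G})$ over all strong orientations $\overrightarrow{G}$ of $G$. *)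

(* Defs.v *)
From mathcomp Require Import all_boot.

Set Implicit Arguments.
Unset Strict Implicit.
Unset Printing Implicit Defensive.

Record sgraph := SGraph {
  vertex :> finType;
  adj : rel vertex;
  adj_sym : symmetric adj;
  adj_irrefl : irreflexive adj }.

Definition connected_rel (T : finType) (e : rel T) : Prop :=
  0 < #|T| /\ forall x y : T, connect e x y.

Definition connected_graph (G : sgraph) : Prop := connected_rel (@adj G).

Definition remove_edge (G : sgraph) (x y : G) : rel G :=
  [rel u v | adj u v && ((u, v) \notin [:: (x, y); (y, x)])].

Definition bridge (G : sgraph) (x y : G) : Prop :=
  adj x y /\ ~ connected_rel (remove_edge x y).

Definition bridgeless (G : sgraph) : Prop := forall x y : G, ~ bridge x y.

Definition dominating (G : sgraph) (D : {set G}) : bool :=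
  [forall x, (x \notin D) ==> [exists y in D, adj x y]].

Definition domination_number (G : sgraph) : nat :=
  #|[arg min_(D < [set: G] | dominating D) #|D|]|.

Definition orientation (G : sgraph) (o : rel G) : Prop :=
  (forall x y : G, o x y -> adj x y) /\
  (forall x y : G, adj x y -> o x y (+) o y x).

Section Digraph.
Variables (T : finType) (o : rel T).

(* [u :: p] is a directed path from u to v; its length is [size p]. *)
Definition dpath (u v : T) (p : seq T) : bool :=
  [&& path o u p, last u p == v & uniq (u :: p)].

Definition strong : Prop := forall u v : T, exists p : seq T, dpath u v p.

(* A path has at most #|T| - 1 arcs, so bounding k by #|T| excludes no path;
   the default value #|T| is taken only when no path from u to v exists. *)
Definition dist (u v : T) : nat :=
  \big[minn/#|T|]_(k < #|T| | [exists p : k.-tuple T, dpath u v p]) k.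

Definition theta (u v : T) : nat := maxn (dist u v) (dist v u).

Definition diam : nat := \max_(u : T) \max_(v : T) theta u v.

End Digraph.

(* d is the minimum of [diam o] over the strong orientations o of G; in
   particular a strong orientation exists. *)
Definition is_oriented_diam (G : sgraph) (d : nat) : Prop :=
  (exists o : rel G, [/\ orientation o, strong o & diam o = d]) /\
  (forall o : rel G, orientation o -> strong o -> d <= diam o).

(* Main.v *)
Require Import Defs.
From mathcomp Require Import all_boot.
From mathcomp Require Import boolp zify.

Set Implicit Arguments.
Unset Strict Implicit.
Unset Printing Implicit Defensive.

(** Upper bound. Fix a spoke from every vertex outside [D] to [D]: the graph becomes a set of nodes
  (the vertices of [D]), each with ports (the other vertices, and a private port for every other edge at
  a vertex of [D]), and edges between ports. Distances are counted twice, so that each node may cost [7].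
  One looks for a partial orientation, covering all nodes and some ports, whose distances are at most
  [7 (#|D| - 1)] plus a small term; it is found by induction on the number of nodes.
  - If some [k >= 2] nodes carry a strongly oriented subgraph within the budget [7 (k - 1)] (a good
    piece), this subgraph is contracted to one node and the induction hypothesis is lifted.
  - Otherwise call block a cycle joining two nodes, of one of two shapes. Two blocks sharing a port would
    yield a good piece. If the blocks did not connect all nodes, a theorem of Yeo's type on properly
    coloured cycles, applied to the components, would produce a cyclic sequence of gadgets, again a good
    piece. So the blocks connect the nodes, and a tree of blocks is grown one node at a time; a block
    costs [6] both ways, or [6] and [8], the latter being compensated by a binary type of the nodes.
  The vertices not covered are coloured so as to maximise the number of bichromatic edges, which puts each
  of them within two steps of [D] in both directions.

  Sharpness. Chain the centres by triangles and 4-cycles alternately and add a triangle at both ends.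
  Whatever the orientation, suitable distances between the ends, one in each direction, sum up to at least
  [7 gamma + 1]. *)

(** * Properly coloured cycles *)

(** A round trip over one block takes 3 + 3 or 3 + 4 arcs, at most 14 when doubled: this is where 7
    per node and direction comes from. A 3 + 4 block overspends by one in one direction and saves
    one in the other. Choosing its direction by the type of the old node, and giving the new node
    the opposite type, makes these excesses telescope along the tree instead of adding up. The tree
    needs blocks that overlap in nodes only: two blocks with a common port could demand opposite
    directions of its spoke. Every such overlap is therefore turned into a good piece. Gadgets are a
    source of good pieces because they have at most three vertices per node. A closed one on [k]
    nodes is strongly connected with distances at most [3 * k - 2] between nodes, and twice this
    fits into [7 * (k - 1)] exactly from [k = 3] on. A closed gadget on two nodes is too small; in
    the cycle argument it is recognised as a block. Bridgelessness forbids two kinds of cut, a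
    single edge and a single spoke. Hence the colour classes of the cycle theorem are single darts
    at some ports and whole ports at others. *)

Section ProperCycle.

Variables (E N : finType) (C : eqType).
Variables (nu : E -> bool -> N) (ka : E -> bool -> C).
Hypothesis ka_nu : forall e b e' b', ka e b = ka e' b' -> nu e b = nu e' b'.

Local Notation dart := (E * bool)%type.
Definition dtl (d : dart) := nu d.1 d.2.
Definition dhd (d : dart) := nu d.1 (~~ d.2).
Definition ktl (d : dart) := ka d.1 d.2.
Definition khd (d : dart) := ka d.1 (~~ d.2).
Definition drev (d : dart) : dart := (d.1, ~~ d.2).

Definition pstep (d d' : dart) := (dhd d == dtl d') && (khd d != ktl d').
Definition nodes (d : dart) s := dtl d :: map dhd (d :: s).
Arguments nodes : simpl never.
Definition pwalk d s := path pstep d s && uniq (nodes d s).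
Definition pcycle c := [&& cycle pstep c, uniq (map dtl c) & 1 < size c].

(** Counterpart of the separating vertex in Yeo's theorem, which is joined to each component of the
    rest in one colour only. As classes are local to a node, the excluded configuration is a set
    entered by exactly the darts of one class. *)
Hypothesis no_class_cut : forall (A : {set N}) x, dtl x \notin A -> dhd x \in A ->
  ~ (forall y, dtl y != dhd y ->
       (dtl y \notin A) && (dhd y \in A) = (ktl y == ktl x)).

Lemma dtl_rev d : dtl (drev d) = dhd d. Proof. by []. Qed.
Lemma dhd_rev d : dhd (drev d) = dtl d.
Proof. by rewrite /dhd /= negbK. Qed.
Lemma ktl_rev d : ktl (drev d) = khd d. Proof. by []. Qed.
Lemma khd_rev d : khd (drev d) = ktl d.
Proof. by rewrite /khd /= negbK. Qed.

Lemma ktl_dtl d d' : ktl d = ktl d' -> dtl d = dtl d'.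
Proof. exact: ka_nu. Qed.

Lemma pstep_rev d d' : pstep (drev d') (drev d) = pstep d d'.
Proof. by rewrite /pstep dhd_rev khd_rev dtl_rev ktl_rev eq_sym (eq_sym (ktl _)). Qed.

Lemma map_dtl d s : path pstep d s ->
  rcons (map dtl (d :: s)) (dhd (last d s)) = nodes d s.
Proof.
rewrite /nodes; elim: s d => [|e s IH] d //= /andP[/andP[/eqP de _] /IH].
by rewrite /= de => ->.
Qed.

Lemma map_dtl_belast d s : path pstep d s ->
  map dtl (d :: s) = dtl d :: map dhd (belast d s).
Proof. by elim: s d => [|e s IH] d //= /andP[/andP[/eqP -> _] /IH /= ->]. Qed.

Lemma nodes_cat d s t : nodes d (s ++ t) = nodes d s ++ map dhd t.
Proof. by rewrite /nodes -cat_cons map_cat. Qed.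

Lemma pwalk_rev q qs : pwalk q qs ->
  exists d s, [/\ map drev (rev (q :: qs)) = d :: s, d = drev (last q qs),
    last d s = drev q, path pstep d s & nodes d s = rev (nodes q qs)].
Proof.
case/andP=> pq _.
case E0 : (map drev (rev (q :: qs))) => [|d s].
  by move: (congr1 size E0); rewrite size_map size_rev.
have dE : d = drev (last q qs).
  have := congr1 (head d) E0; rewrite lastI rev_rcons /=.
  by [].
have lE : last d s = drev q.
  by have := congr1 (last d) E0; rewrite rev_cons map_rcons last_rcons /=.
have pds : path pstep d s.
  have : sorted pstep (d :: s).
    rewrite -E0 sorted_map rev_sorted.
    by rewrite (@eq_sorted _ _ pstep) // => x y; rewrite /= pstep_rev.
  by [].
exists d, s; split=> //; rewrite -(map_dtl pq) rev_rcons /nodes -E0 dE dtl_rev.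
congr (_ :: _); rewrite -map_rev -map_comp; apply: eq_map => x /=.
by rewrite dhd_rev.
Qed.

Definition reaches x w := exists d s,
  [/\ ktl d = ktl x, pwalk d s & dhd (last d s) = w].

Lemma reaches_nodes x d s v : ktl d = ktl x -> pwalk d s ->
  v \in map dhd (d :: s) -> reaches x v.
Proof.
move=> kx /andP[pd ud] /mapP[y yin ->].
move: yin; rewrite inE => /predU1P[->|/splitPr yin].
  exists d, [::]; split=> //; rewrite /pwalk /= /nodes /=.
  by move: ud; rewrite /nodes /= inE !negb_or => /andP[/andP[-> _] _].
case: yin pd ud => s1 s2.
rewrite -cat_rcons cat_path => /andP[pd _] ud.
exists d, (rcons s1 y); split; rewrite ?last_rcons //.
rewrite /pwalk pd /=; move: ud; rewrite /nodes -cat_cons map_cat -cat_cons cat_uniq.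
by case/andP.
Qed.

Lemma pcycleI d s : path pstep d s -> pstep (last d s) d ->
  uniq (map dtl (d :: s)) -> 0 < size s -> pcycle (d :: s).
Proof.
by move=> pd ld ud ss; rewrite /pcycle ud /= rcons_path pd ld.
Qed.

(* Minimise the set of nodes reachable by proper walks leaving through a given class:
   if there is no proper cycle, the class cut provided by the hypothesis yields a node [a]
   all of whose arrivals have the same class, and leaving [a] through another class
   reaches strictly fewer nodes. *)
Theorem proper_cycle_exists : (exists x, dtl x != dhd x) -> exists c, pcycle c.
Proof.
case=> x0 x0P; apply: contrapT => noc.
pose Rs x : {set N} := [set w | `[< reaches x w >]].
case: (@arg_minnP _ x0 (fun x => dtl x != dhd x) (fun x => #|Rs x|) x0P) => x xP xmin.
have RsP y w : reflect (reaches y w) (w \in Rs y).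
  by rewrite inE; apply: asboolP.
have walk1 y : dtl y != dhd y -> pwalk y [::].
  by move=> yP; rewrite /pwalk /nodes /= inE yP.
have start_notin y d s : ktl d = ktl y -> pwalk d s -> dtl y \notin map dhd (d :: s).
  by move=> kd /andP[_]; rewrite /nodes -(ktl_dtl kd) => /andP[].
have bA : dtl x \notin Rs x.
  apply/RsP=> -[d [s [kd wd ld]]]; have := start_notin _ _ _ kd wd.
  by rewrite -ld (map_f dhd (mem_last d s)).
have hA : dhd x \in Rs x.
  by apply/RsP; exists x, [::]; split=> //; apply: walk1.
(* Otherwise the darts entering [Rs x] would be exactly the class of [x]: every dart of that class
   starts at [dtl x], and its head is reached in one step. *)
have [y [yP ycross ykt]] : exists y, [/\ dtl y != dhd y,
    (dtl y \notin Rs x) && (dhd y \in Rs x) & ktl y != ktl x].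
  apply: contrapT => ny; apply: (no_class_cut bA hA) => y yP.
  case: eqP => [ky|/eqP ky].
    rewrite (ktl_dtl ky) bA /=; apply/RsP; exists y, [::]; split=> //.
    exact: walk1.
  by apply/negbTE/negP => yc; apply: ny; exists y.
set a := dhd y in ycross *; case/andP: ycross => zA aA.
(* An arrival at [a] in another class could be prolonged along the reverse of [y]. This closes a
   proper cycle if [dtl y = dtl x], as [y] and [x] differ in class there, and otherwise reaches
   [dtl y], which lies outside [Rs x]. *)
have arr d s : ktl d = ktl x -> pwalk d s -> dhd (last d s) = a ->
    khd (last d s) = khd y.
  move=> kd wd ld; apply/eqP/contraT => kne.
  have [pd ud] := andP wd.
  have st : pstep (last d s) (drev y).
    by rewrite /pstep dtl_rev ktl_rev ld eqxx.
  have pd' : path pstep d (rcons s (drev y)) by rewrite rcons_path pd.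
  have [zb|zb] := eqVneq (dtl y) (dtl x).
    case: noc; exists (d :: rcons s (drev y)); apply: pcycleI => //.
    - rewrite last_rcons /pstep dhd_rev khd_rev zb (ktl_dtl kd) eqxx /=.
      by rewrite kd.
    - by rewrite map_cons map_rcons dtl_rev -rcons_cons -map_cons -/a -ld map_dtl.
    - by rewrite size_rcons.
  case/RsP: (zA); apply: (@reaches_nodes x d (rcons s (drev y))) => //.
    rewrite /pwalk pd' andTb /nodes -rcons_cons map_rcons -rcons_cons rcons_uniq.
    rewrite -/(nodes d s) ud andbT /nodes in_cons negb_or (ktl_dtl kd) dhd_rev zb /=.
    apply/negP => zin; case/RsP: zA; exact: reaches_nodes wd zin.
  by rewrite -rcons_cons map_rcons mem_rcons inE dhd_rev eqxx.
(* If every dart leaving [a] had the class of the reverse of [y], this class would be the cut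
   between [a] and its complement. *)
have [u [utl ukt uP]] : exists u, [/\ dtl u = a, ktl u != khd y & dtl u != dhd u].
  have zN : dtl y \in ~: [set a] by rewrite inE in_set1; move: yP.
  apply: contrapT => nu'.
  have aN : dtl (drev y) \notin ~: [set a] by rewrite !inE negbK dtl_rev.
  have := @no_class_cut (~: [set a]) (drev y) aN; rewrite dhd_rev => /(_ zN); apply.
  move=> v vP; rewrite !inE negbK ktl_rev.
  case: (ktl v =P khd y) => [kv|/eqP kv].
    have ta : dtl v = a by rewrite (ktl_dtl (_ : ktl v = ktl (drev y))).
    by rewrite ta eqxx -ta eq_sym vP.
  apply/negbTE/negP => /andP[/eqP ta _]; apply: nu'; by exists v.
suff /proper_card : Rs u \proper Rs x.
  by rewrite ltnNge xmin.
apply/properP; split; last first.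
  exists a => //; apply/RsP => -[d [s [kd wd ld]]].
  have := start_notin _ _ _ kd wd.
  by rewrite utl -ld (map_f dhd (mem_last d s)).
case/RsP: (aA) => d [s [kd wd ld]]; have [pd ud] := andP wd.
have kda := arr _ _ kd wd ld.
apply/subsetP => v /RsP[q [qs [kq wq lq]]].
have qa : dtl q = a by rewrite -utl; apply: ktl_dtl.
have dq : pstep (last d s) q.
  by rewrite /pstep ld qa eqxx kda kq eq_sym.
have noback d1 s1 : ktl d1 = ktl x -> pwalk d1 s1 -> last d1 s1 = drev q -> False.
  move=> k1 w1 l1; have := arr _ _ k1 w1; rewrite l1 dhd_rev khd_rev => /(_ qa) kq'.
  by move: ukt; rewrite -kq kq' eqxx.
have uq r : pwalk q r -> ~~ has (mem (nodes d s)) (map dhd (q :: r)) ->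
    pwalk d (s ++ q :: r).
  move=> /andP[pq uq] dis; rewrite /pwalk nodes_cat cat_uniq cat_path pd ud dis.
  have pdq : path pstep (last d s) (q :: r) by apply/andP.
  by rewrite pdq; move: uq => /andP[].
suff disj r : pwalk q r -> ~~ has (mem (nodes d s)) (map dhd (q :: r)).
  have := uq _ wq (disj _ wq) => wdq; apply/RsP.
  apply: (reaches_nodes kd wdq); rewrite -lq; apply: map_f.
  by rewrite inE mem_cat mem_last !orbT.
(* Suppose that the walk from [a] first returns to [d s] at [w]. If the classes at [w] differ, both
   walks close up to a proper cycle. If they agree, following [d s] up to [w] and then the second
   walk backwards is proper, and it arrives at [a] in the class of [q], against [arr]. *)
have key r' w : pwalk q r'  -> dhd (last q r') = w ->
    ~~ has (mem (nodes d s)) (map dhd (belast q r')) -> w \notin nodes d s.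
  move=> wr lw dis; have [pr ur] := andP wr; apply/negP => win.
  have wa : w != a.
    move: ur; rewrite /nodes qa => /andP[+ _]; apply: contraNneq => <-.
    by rewrite -lw (map_f dhd (mem_last q r')).
  move: win; rewrite -(map_dtl pd) mem_rcons inE ld (negbTE wa) orFb => /mapP[p' p'in wE].
  have qrE : map dtl (q :: r') = a :: map dhd (belast q r').
    by rewrite map_dtl_belast // qa.
  case/splitPr def: {1 2}(d :: s) / p'in => [s1 s2].
  have [kk|kk] := eqVneq (khd (last q r')) (ktl p'); last first.
    case: noc; exists (p' :: s2 ++ q :: r').
    have pdall : sorted pstep ((d :: s) ++ q :: r') by rewrite /= cat_path pd /= dq pr.
    have pp : path pstep p' (s2 ++ q :: r').
      by move: pdall; rewrite def -catA => /cat_sorted2[_].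
    apply: pcycleI => //.
    - by rewrite last_cat /= /pstep lw wE eqxx.
    - rewrite -cat_cons map_cat qrE.
      have u1 : uniq (rcons (map dtl (d :: s)) a) by rewrite -ld map_dtl.
      move: u1; rewrite def map_cat rcons_cat cat_uniq => /and3P[_ _ u2].
      rewrite -cat_rcons cat_uniq u2 andTb; apply/andP; split; last first.
        by move: ur; rewrite -(map_dtl pr) rcons_uniq qrE => /andP[_] /andP[].
      apply: contra dis => /hasP[z z1 z2]; apply/hasP; exists z => //.
      rewrite -[mem _ z]/(z \in nodes d s).
      by rewrite -(map_dtl pd) def ld map_cat rcons_cat mem_cat z2 orbT.
    - by rewrite size_cat addnS.
  have [d' [s' [dsE d'E l' p's' n']]] := pwalk_rev wr.
  have nd' : nodes d' s' = w :: rev (a :: map dhd (belast q r')).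
    by rewrite n' -(map_dtl pr) rev_rcons lw qrE.
  have hd' : map dhd (d' :: s') = rev (a :: map dhd (belast q r')).
    by move: nd'; rewrite /nodes => -[].
  case: s1 def => [|d1 s1] def.
    case: def => dE _; apply: (noback d' s') => //.
      by rewrite d'E ktl_rev kk -dE.
    by rewrite /pwalk p's' n' rev_uniq.
  have d1E : d1 = d by case: def.
  rewrite {}d1E in def; case: def => sE.
  have pd2 : path pstep d (s1 ++ d' :: s').
    move: pd; rewrite sE !cat_path /= => /and3P[-> /andP[h1 h2] _] /=.
    rewrite p's' andbT /pstep d'E dtl_rev ktl_rev lw wE (eqP h1) eqxx kk.
    exact: h2.
  apply: (noback d (s1 ++ d' :: s')) => //; last by rewrite last_cat.
  rewrite /pwalk pd2 andTb nodes_cat cat_uniq hd'.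
  have ndE : nodes d s = nodes d s1 ++ map dhd (p' :: s2).
    by rewrite sE nodes_cat.
  have := ud; rewrite ndE cat_uniq => /and3P[u1 u2 _].
  rewrite u1 rev_uniq andTb.
  apply/andP; split.
    apply/hasP => -[z]; rewrite mem_rev inE => /predU1P[->|z1] z2.
      case/hasP: u2; exists a => //.
      have := congr1 (last a) ndE; rewrite last_cat -(map_dtl pd) last_rcons ld => e.
      by rewrite [X in X \in _]e; apply: (mem_last (dhd p') (map dhd s2)).
    by case/hasP: dis; exists z => //; rewrite -[mem _ z]/(z \in nodes d s) ndE mem_cat z2.
  move: ur; rewrite -(map_dtl pr) rcons_uniq qrE => /andP[_].
  by [].
move=> wr; elim/last_ind: r wr => [|r e IH] wr.
  have := key [::] (dhd q) wr erefl isT.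
  by rewrite /= orbF.
have wr' : pwalk q r.
  move: wr; rewrite /pwalk rcons_path => /andP[/andP[-> _]].
  by rewrite -cats1 nodes_cat cat_uniq => /andP[].
have := key (rcons r e) (dhd e) wr; rewrite last_rcons belast_rcons => /(_ erefl (IH wr')).
by rewrite -rcons_cons map_rcons has_rcons /= => /negbTE ->; exact: IH.
Qed.
End ProperCycle.

(** * Instances, good pieces and gadgets *)

Section Reach.
Variables (T : finType) (o : rel T).

Definition reach n x y := exists p, [/\ path o x p, last x p = y & size p <= n].

Lemma reach0 n x : reach n x x.
Proof. by exists [::]. Qed.

Lemma reach1 n x y : o x y -> 0 < n -> reach n x y.
Proof. by move=> xy n0; exists [:: y]; rewrite /= xy. Qed.

Lemma reach_le n m x y : n <= m -> reach n x y -> reach m x y.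
Proof. by move=> nm [p [? ? sp]]; exists p; split=> //; apply: leq_trans nm. Qed.

Lemma reach_trans n m y x z : reach n x y -> reach m y z -> reach (n + m) x z.
Proof.
move=> [p [p1 p2 p3]] [q [q1 q2 q3]]; exists (p ++ q).
by rewrite cat_path last_cat size_cat p1 p2 q1 q2; split=> //; apply: leq_add.
Qed.

(* [q] can only be entered through [y], so a path without repetition ending in [y] avoids it. *)
Lemma connect_reach_avoid (A : {set T}) x y q : (forall u v, o u v -> v \in A) ->
  x \in A -> connect o x y -> q \in A -> q != x -> q != y ->
  (forall u, o u q -> u = y) -> reach (#|A| - 2) x y.
Proof.
move=> oA xA /connectP[p0 /shortenP[p p1 p2 _] ->] qA qx qy qP; exists p; split=> //.
have qn : q \notin p.
  apply/negP => /splitPr qp; case: qp p1 p2 qy qP => s1 s2.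
  rewrite cat_path /= => /and3P[_ e _] u; rewrite last_cat /= => qy qP.
  have : uniq ((x :: s1) ++ q :: s2) by rewrite /=.
  rewrite cat_uniq => /and3P[_ /hasP[]].
  by exists (last q s2); rewrite ?mem_last // -(qP _ e) mem_last.
have sub : x :: p \subset A :\ q.
  apply/subsetP => v; rewrite !inE => /predU1P[->|vp]; first by rewrite eq_sym qx.
  rewrite (contraNneq _ qn) /=; last by move=> <-.
  elim: p x p1 vp {p2 qn xA qx qy qP} => [|z p IH] x //= /andP[xz pz].
  by rewrite inE => /predU1P[->|/(IH _ pz)//]; apply: oA xz.
have := subset_leq_card sub; rewrite (card_uniqP p2) /=.
by rewrite (cardsD1 q A) qA; lia.
Qed.

Lemma connect_reach (A : {set T}) x y : (forall u v, o u v -> v \in A) -> x \in A ->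
  connect o x y -> reach (#|A|.-1) x y.
Proof.
move=> oA xA /connectP[p0 /shortenP[p p1 p2 _] ->]; exists p; split=> //.
have sub : x :: p \subset A.
  apply/subsetP => v; rewrite !inE => /predU1P[->|vp] //.
  elim: p x p1 vp {p2 xA} => [|z p IH] x //= /andP[xz pz].
  by rewrite inE => /predU1P[->|/(IH _ pz)//]; apply: oA xz.
by have := subset_leq_card sub; rewrite (card_uniqP p2) /=; lia.
Qed.

End Reach.

Lemma reach_hom (T T' : finType) (o : rel T) (o' : rel T') (h : T -> T') :
  (forall x y, o x y -> reach o' 1 (h x) (h y)) ->
  forall n x y, reach o n x y -> reach o' n (h x) (h y).
Proof.
move=> ho n x y [p [p1 <- sp]]; apply: (reach_le sp) => {sp}.
elim: p x p1 => [|z p IH] x /=; first by move=> _; apply: reach0.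
by case/andP=> xz /IH; rewrite -add1n; apply: reach_trans; apply: ho.
Qed.

Lemma reach_sub (T : finType) (o o' : rel T) n x y : subrel o o' ->
  reach o n x y -> reach o' n x y.
Proof. by move=> oo; apply: (reach_hom (h := id)) => u v /oo uv; apply: reach1. Qed.

Lemma reach_rev (T : finType) (o : rel T) n x y :
  reach (fun u v => o v u) n x y -> reach o n y x.
Proof.
case=> p [p1 p2 p3]; exists (rev (belast x p)).
by rewrite -p2 rev_path p1 size_rev size_belast; split=> //; case: p {p1 p2 p3} => //= z p;
  rewrite rev_cons last_rcons.
Qed.

(* A graph with a dominating set, its spokes made explicit: nodes are the dominating vertices,
   ports the other ends of edges, [own] the chosen spoke of a port. *)
Record inst := Inst {
  iE : finType; iN : finType; iL : finType;
  pi : iE -> bool -> iL;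
  own : iL -> iN }.

Section Instance.
Variable I : inst.
Local Notation E := (iE I).
Local Notation N := (iN I).
Local Notation L := (iL I).
Local Notation V := (N + L)%type.

Definition crossing (A : {set N}) (d : E * bool) :=
  (own (pi d.1 d.2) \notin A) && (own (pi d.1 (~~ d.2)) \in A).

Record inst_ok : Prop := InstOk {
  ok_simple : forall e b e' b', pi e b = pi e' b' :> L -> pi e (~~ b) = pi e' (~~ b') ->
    e = e' :> E;
  ok_irr : forall (e : E) b, pi e b <> pi e (~~ b) :> L;
  ok_conn : forall A : {set N}, A != set0 -> A != setT -> exists d, crossing A d;
  ok_edge : forall (A : {set N}) d, ~ (forall d', crossing A d' = (d' == d));
  ok_spoke : forall (A : {set N}) (l : L), A != set0 -> own l \notin A ->
    ~ (forall d, crossing A d = (pi d.1 d.2 == l)) }.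

Definition edge (l l' : L) := [exists d : E * bool, (pi d.1 d.2 == l) && (pi d.1 (~~ d.2) == l')].

Definition adjI (u v : V) : bool :=
  match u, v with
  | inl n, inr l => own l == n
  | inr l, inl n => own l == n
  | inr l, inr l' => edge l l'
  | inl _, inl _ => false
  end.

Definition home (u : V) : N := match u with inl n => n | inr l => own l end.
Definition inS (DS : {set N}) (XS : {set L}) (u : V) :=
  match u with inl n => n \in DS | inr l => l \in XS end.
(* The weight of a port is the doubled length of one edge: a path of the contracted graph reaches the piece
   either at a node, or at a port one edge before the contracted node. *)
Definition wt (u : V) := match u with inl _ => 0 | inr _ => 2 end.

Definition spoked (a : rel V) l := a (inr l) (inl (own l)) || a (inl (own l)) (inr l).

Record good_piece (DS : {set N}) (XS : {set L}) (a : rel V) : Prop := GoodPiece {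
  gp_two : 1 < #|DS|;
  gp_own : forall l, l \in XS -> own l \in DS;
  gp_sub : forall u v, a u v -> [/\ adjI u v, inS DS XS u & inS DS XS v];
  gp_anti : forall u v, a u v -> ~~ a v u;
  gp_spoke : forall l, l \in XS -> spoked a l;
  gp_dist : forall u v, inS DS XS u -> inS DS XS v ->
    exists2 s, reach a s u v & 2 * s <= 7 * (#|DS| - 1) + wt u + wt v }.

Definition good := exists DS XS a, good_piece DS XS a.

Lemma edge_sym l l' : edge l l' -> edge l' l.
Proof.
case/existsP=> -[e b] /= /andP[/eqP h1 /eqP h2]; apply/existsP; exists (e, ~~ b).
by rewrite /= negbK h1 h2 !eqxx.
Qed.

Lemma edge_irr l : inst_ok -> ~~ edge l l.
Proof.
move=> ok; apply/existsP => -[[e b] /= /andP[/eqP h1 /eqP h2]].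
by apply: (ok_irr ok (e := e) (b := b)); rewrite h1 h2.
Qed.

Lemma adjI_sym u v : adjI u v -> adjI v u.
Proof. by case: u v => [n|l] [m|l'] //=; apply: edge_sym. Qed.

(** A passage from port [a] to port [b] through the nodes [Ns]. The port [q] in [g_priv] can be
    entered from [n] only, so a path without repetition that ends in [n] avoids it, which saves one
    arc between nodes. The clause [q != a] preserves this when joining adds an arc into [a]. *)
Record gadget (Ns : {set N}) (a b : L) (Vg : {set V}) (ag : rel V) : Prop := Gadget {
  g_sub : forall u v, ag u v -> [/\ adjI u v, u \in Vg & v \in Vg];
  g_anti : forall u v, ag u v -> ~~ ag v u;
  g_a : inr a \in Vg;
  g_b : inr b \in Vg;
  g_from : forall v, v \in Vg -> connect ag (inr a) v;
  g_to : forall v, v \in Vg -> connect ag v (inr b);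
  g_card : #|Vg| <= 3 * #|Ns|;
  g_node : forall n, n \in Ns -> inl n \in Vg;
  g_home : forall u, u \in Vg -> home u \in Ns;
  g_priv : forall n, n \in Ns -> exists q, [/\ inr q \in Vg, q != a & forall u, ag u (inr q) -> u = inl n];
  g_spoke : forall l, inr l \in Vg -> spoked ag l }.

Definition gad Ns a b := exists Vg ag, gadget Ns a b Vg ag.

(** With entry equal to exit the gadget is strongly connected, so [3 * k - 1] arcs always suffice
    for [k] nodes, and [3 * k - 2] between two nodes because the private port of the target is
    avoided. Both node-to-node and node-to-port budgets then hold from [k = 3] on. *)
Lemma good_gad Ns a : gad Ns a a -> 2 < #|Ns| -> good.
Proof.
move=> [Vg [ag g]] k3; exists Ns, [set l | inr l \in Vg], ag.
have inE' u : inS Ns [set l | inr l \in Vg] u = (u \in Vg).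
  case: u => [n|l] /=; last by rewrite inE.
  by apply/idP/idP => [/(g_node g)|/(g_home g)].
have oA u v : ag u v -> v \in Vg by case/(g_sub g).
have con u v : u \in Vg -> v \in Vg -> connect ag u v.
  by move=> uV vV; apply: connect_trans (g_to g uV) (g_from g vV).
have c3 := g_card g.
have c0 : 0 < #|Vg| by apply/card_gt0P; exists (inr a); apply: g_a g.
split=> //.
- by lia.
- by move=> l; rewrite inE => /(g_home g).
- by move=> u v /(g_sub g)[? ? ?]; rewrite !inE'.
- exact: g_anti g.
- by move=> l; rewrite inE => /(g_spoke g).
move=> u v; rewrite !inE' => uV vV.
have def : reach ag (#|Vg|.-1) u v by apply: connect_reach => //; apply: con.
case: u uV def => [n|l] uV def; last first.
  by exists (#|Vg|.-1) => //; case: v {vV def} => m; rewrite /wt; lia.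
case: v vV def => [m|l] vV def; last by exists (#|Vg|.-1) => //; rewrite /wt; lia.
have [->|nm] := eqVneq n m; first by exists 0; [apply: reach0|lia].
have [q [qV qa qP]] := g_priv g (g_home g vV).
exists (#|Vg| - 2); last by rewrite /wt; lia.
by apply: (connect_reach_avoid (q := inr q)) => //; apply: con.
Qed.

Definition tri a := exists2 w, own w = own a & edge a w.

Lemma gad_pass n a b : own a = n -> own b = n -> a != b -> gad [set n] a b.
Proof.
move=> an bn ab.
exists [set inr a; inl n; inr b].
pose r := [rel u v : V | ((u == inr a) && (v == inl n)) || ((u == inl n) && (v == inr b))].
have e1 : r (inr a) (inl n) by rewrite /= !eqxx.
have e2 : r (inl n) (inr b) by rewrite /= !eqxx ?orbT.
have c1 : connect r (inr a) (inl n) by exact: connect1.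
have c2 : connect r (inl n) (inr b) by exact: connect1.
exists r; split.
- move=> u v /orP[] /andP[/eqP -> /eqP ->]; rewrite /= ?an ?bn eqxx !inE !eqxx ?orbT; split=> //.
- move=> u v /orP[] /andP[/eqP -> /eqP ->]; apply/negP => /orP[] /andP[/eqP e /eqP f];
  by move/eqP: ab => ab; congruence.
- by rewrite !inE eqxx.
- by rewrite !inE eqxx !orbT.
- move=> v; rewrite !inE -orbA => /or3P[] /eqP -> //.
  exact: connect_trans c1 c2.
- move=> v; rewrite !inE -orbA => /or3P[] /eqP -> //.
  exact: connect_trans c1 c2.
- rewrite cards1; apply: leq_trans (leq_card_setU _ _) _.
  by rewrite cards1 cards2; case: (_ != _).
- by move=> m; rewrite !inE => /eqP ->; rewrite eqxx orbT.
- by move=> v; rewrite !inE -orbA => /or3P[] /eqP -> /=; rewrite ?an ?bn.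
- move=> m; rewrite inE => /eqP ->; exists b; rewrite !inE eqxx !orbT eq_sym ab; split=> //.
  by move=> u /orP[] /andP[/eqP -> //].
- move=> l; rewrite !inE /= orbF => /orP[] /eqP[->]; rewrite /spoked.
    by apply/orP; left; rewrite an.
  by apply/orP; right; rewrite bn.
Qed.

Lemma gad_tri n p w : inst_ok -> own p = n -> own w = n -> edge p w -> gad [set n] p p.
Proof.
move=> ok pn wn pw.
have pw' : p != w by apply: contraTneq pw => ->; apply: edge_irr.
exists [set inr p; inl n; inr w].
pose r := [rel u v : V | ((u == inr p) && (v == inl n)) || ((u == inl n) && (v == inr w)) ||
  ((u == inr w) && (v == inr p))].
have e1 : r (inr p) (inl n) by rewrite /= !eqxx.
have e2 : r (inl n) (inr w) by rewrite /= !eqxx ?orbT.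
have e3 : r (inr w) (inr p) by rewrite /= !eqxx ?orbT.
have c1 : connect r (inr p) (inl n) by exact: connect1.
have c2 : connect r (inl n) (inr w) by exact: connect1.
have c3 : connect r (inr w) (inr p) by exact: connect1.
exists r; split.
- move=> u v; rewrite /r /= -orbA => /or3P[] /andP[/eqP -> /eqP ->];
  rewrite /= ?pn ?wn ?eqxx ?(edge_sym pw) !inE !eqxx ?orbT; split=> //.
- move=> u v /orP[/orP[]|] /andP[/eqP -> /eqP ->]; apply/negP => /orP[/orP[]|] /andP[/eqP e /eqP f];
  by move/eqP: pw' => pw'; congruence.
- by rewrite !inE eqxx.
- by rewrite !inE eqxx.
- move=> v; rewrite !inE -orbA => /or3P[] /eqP -> //.
  exact: connect_trans c1 c2.
- move=> v; rewrite !inE -orbA => /or3P[] /eqP -> //.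
  exact: connect_trans c2 c3.
- rewrite cards1; apply: leq_trans (leq_card_setU _ _) _.
  by rewrite cards1 cards2; case: (_ != _).
- by move=> m; rewrite !inE => /eqP ->; rewrite eqxx orbT.
- by move=> v; rewrite !inE -orbA => /or3P[] /eqP -> /=; rewrite ?pn ?wn.
- move=> m; rewrite inE => /eqP ->; exists w; rewrite !inE eqxx !orbT eq_sym pw'; split=> //.
  move=> u; rewrite /r /= -orbA => /or3P[] /andP[/eqP -> //] /eqP[wp].
  by rewrite wp eqxx in pw'.
- move=> l; rewrite !inE /= orbF => /orP[] /eqP[->]; rewrite /spoked.
    by apply/orP; left; rewrite pn.
  by apply/orP; right; rewrite wn.
Qed.

Lemma gad_unit a b : inst_ok -> own a = own b -> a != b \/ tri a -> gad [set own a] a b.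
Proof.
move=> ok ab; have [<-|ne _] := eqVneq a b; last exact: gad_pass.
by case=> // -[w wa aw]; apply: (gad_tri ok _ wa aw).
Qed.

(* With [cl] the two gadgets are closed into a cycle, without it they are put in series. *)
Lemma gad_join (cl : bool) N1 N2 a b1 a2 b2 c : gad N1 a b1 -> gad N2 a2 b2 ->
  [disjoint N1 & N2] -> edge b1 a2 ->
  (cl -> edge b2 a /\ ~ (b1 = a /\ a2 = b2)) ->
  (c == b2) || cl && (c \in [:: a; b1; a2]) -> gad (N1 :|: N2) a c.
Proof.
move=> [V1 [r1 g1]] [V2 [r2 g2]] dis e12 cle cE.
have hne u v : u \in V1 -> v \in V2 -> home u = home v -> False.
  move=> /(g_home g1) h1 /(g_home g2) h2 h; move: (disjointFr dis h1).
  by rewrite h h2.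
have ne12 u v : u \in V1 -> v \in V2 -> u = v -> False.
  by move=> h1 h2 h; apply: (hne u v) => //; rewrite h.
pose l1 := [rel u v : V | (u == inr b1) && (v == inr a2)].
pose l2 := [rel u v : V | [&& cl, u == inr b2 & v == inr a]].
pose r := [rel u v : V | [|| r1 u v, r2 u v, l1 u v | l2 u v]].
have [aV bV aV2 bV2] : [/\ inr a \in V1, inr b1 \in V1, inr a2 \in V2 & inr b2 \in V2].
  by split; [exact: g_a g1|exact: g_b g1|exact: g_a g2|exact: g_b g2].
have rP u v : r u v -> [\/ [/\ r1 u v, u \in V1 & v \in V1], [/\ r2 u v, u \in V2 & v \in V2],
    [/\ u = inr b1, v = inr a2, u \in V1 & v \in V2] | [/\ cl, u = inr b2, v = inr a & u \in V2 /\ v \in V1]].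
  case/or4P.
  - by move=> h; constructor 1; have [_ ? ?] := g_sub g1 h.
  - by move=> h; constructor 2; have [_ ? ?] := g_sub g2 h.
  - by case/andP=> /eqP -> /eqP ->; constructor 3.
  - by case/and3P=> ? /eqP -> /eqP ->; constructor 4.
have s1 : subrel (connect r1) (connect r).
  by apply: connect_sub => u v h; apply: connect1; rewrite /r /= h.
have s2 : subrel (connect r2) (connect r).
  by apply: connect_sub => u v h; apply: connect1; rewrite /r /= h orbT.
have sl1 : connect r (inr b1) (inr a2) by apply: connect1; rewrite /r /= !eqxx !orbT.
have sl2 : cl -> connect r (inr b2) (inr a).
  by move=> h; apply: connect1; rewrite /r /= h !eqxx !orbT.
have from v : v \in V1 :|: V2 -> connect r (inr a) v.
  case/setUP=> vV; first exact/s1/(g_from g1).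
  apply: connect_trans (s1 _ _ (g_to g1 aV)) _; apply: connect_trans sl1 _.
  exact/s2/(g_from g2).
have to v : v \in V1 :|: V2 -> connect r v (inr b2).
  case/setUP=> vV; last exact/s2/(g_to g2).
  apply: connect_trans (s1 _ _ (g_to g1 vV)) _; apply: connect_trans sl1 _.
  exact/s2/(g_from g2).
have cV : inr c \in V1 :|: V2.
  case/orP: cE => [/eqP ->|/andP[_]]; first by rewrite inE bV2 orbT.
  by rewrite !inE => /or3P[] /eqP ->; rewrite ?aV ?bV ?aV2 ?orbT.
exists (V1 :|: V2), r; split=> //.
- move=> u v ruv; case: (rP _ _ ruv) => [[h uV vV]|[h uV vV]|[-> -> uV vV]|[h -> -> [uV vV]]].
  + by rewrite !inE uV vV; have [-> _ _] := g_sub g1 h.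
  + by rewrite !inE uV vV !orbT; have [-> _ _] := g_sub g2 h.
  + by rewrite !inE uV vV !orbT.
  + by rewrite !inE uV vV !orbT; have [? _] := cle h.
- move=> u v /rP ruv; apply/negP => /rP rvu; move: ruv rvu.
  move=> [[h uV vV]|[h uV vV]|[uE vE uV vV]|[h uE vE [uV vV]]];
  move=> [[h' uV' vV']|[h' uV' vV']|[uE' vE' uV' vV']|[h' uE' vE' [uV' vV']]].
  + by move: (g_anti g1 h); rewrite h'.
  + by apply: (ne12 u u).
  + by apply: (ne12 u u).
  + by apply: (ne12 v v).
  + by apply: (ne12 u u).
  + by move: (g_anti g2 h); rewrite h'.
  + by apply: (ne12 v v).
  + by apply: (ne12 u u).
  + by apply: (ne12 v v).
  + by apply: (ne12 u u).
  + by apply: (ne12 v v).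
  + have [_ []] := cle h'; split.
      by move: vE'; rewrite uE => -[].
    by move: uE'; rewrite vE => -[].
  + by apply: (ne12 u u).
  + by apply: (ne12 v v).
  + have [_ []] := cle h; split.
      by move: uE'; rewrite vE => -[].
    by move: vE'; rewrite uE => -[].
  + by apply: (ne12 v v).
- by rewrite inE aV.
- move=> v vV; case/orP: cE => [/eqP ->|/andP[h _]]; first exact: to.
  apply: connect_trans (to _ vV) _; apply: connect_trans (sl2 h) _; exact: from.
- rewrite [#|N1 :|: N2|]cardsU (disjoint_setI0 dis) cards0 subn0 mulnDr.
  apply: leq_trans (leq_card_setU _ _) _; apply: leq_add; [exact: g_card g1|exact: g_card g2].
- by move=> n; rewrite !inE => /orP[/(g_node g1)|/(g_node g2)] ->; rewrite ?orbT.
- by move=> u; rewrite !inE => /orP[/(g_home g1)|/(g_home g2)] ->; rewrite ?orbT.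
- move=> n; rewrite inE => /orP[nN|nN].
    have [q [qV qa qP]] := g_priv g1 nN; exists q; rewrite inE qV qa; split=> //.
    move=> u /rP[[h uV vV]|[h uV vV]|[uE vE uV vV]|[h uE vE [uV vV]]].
    + exact: qP.
    + by case: (ne12 _ _ qV vV).
    + by case: (ne12 _ _ qV vV).
    + by case: vE => qE; rewrite qE eqxx in qa.
  have [q [qV qa qP]] := g_priv g2 nN; exists q; rewrite inE qV orbT; split=> //.
    by apply/eqP => qE; apply: (ne12 (inr a) (inr q)) => //; rewrite qE.
  move=> u /rP[[h uV vV]|[h uV vV]|[uE vE uV vV]|[h uE vE [uV vV]]].
  + by case: (ne12 _ _ vV qV).
  + exact: qP.
  + by case: vE => qE; rewrite qE eqxx in qa.
  + by case: (ne12 _ _ vV qV).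
- move=> l; rewrite inE => /orP[/(g_spoke g1)|/(g_spoke g2)]; rewrite /spoked /r /=.
    by case/orP=> ->; rewrite ?orbT.
  by case/orP=> ->; rewrite ?orbT.
Qed.

End Instance.

(** * Blocks *)

(** Breadth-first search on vertex numbers: distances in a small explicit orientation are thus
    settled by computation, independently of the instance in which it is found. *)
Fixpoint ball (arcs : seq (nat * nat)) s (l : seq nat) :=
  if s is s'.+1 then ball arcs s' (undup (l ++ [seq a.2 | a <- arcs & a.1 \in l])) else l.

Section Pattern.
Variables (T : finType) (x0 : T) (vs : seq T) (arcs : seq (nat * nat)).
Hypothesis uvs : uniq vs.
Hypothesis arcs_lt : all (fun a => (a.1 < size vs) && (a.2 < size vs)) arcs.

Definition prel : rel T := [rel u v | (index u vs, index v vs) \in arcs].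

Lemma prel_nth i j : (i, j) \in arcs -> prel (nth x0 vs i) (nth x0 vs j).
Proof.
by move=> ij; have /= /andP[? ?] := allP arcs_lt _ ij; rewrite /prel /= !index_uniq.
Qed.

Lemma prel_in u v : prel u v -> exists i j, [/\ (i, j) \in arcs, u = nth x0 vs i,
  v = nth x0 vs j, u \in vs & v \in vs].
Proof.
move=> uv; have /= /andP[] := allP arcs_lt _ uv; rewrite !index_mem => uv1 uv2.
by exists (index u vs), (index v vs); rewrite !nth_index.
Qed.

Lemma prel_ball s l j : j \in ball arcs s l ->
  exists2 i, i \in l & reach prel s (nth x0 vs i) (nth x0 vs j).
Proof.
elim: s l => [|s IH] l /=; first by move=> jl; exists j => //; apply: reach0.
case/IH => i; rewrite mem_undup mem_cat => /orP[il|].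
  by move=> re; exists i => //; apply: reach_le re.
case/mapP=> -[i' i''] /=; rewrite mem_filter /= => /andP[i'l ii] -> re.
exists i' => //; rewrite -add1n; apply: reach_trans re.
by apply: reach1 => //; apply: prel_nth.
Qed.

Lemma prel_reach s u v : u \in vs -> v \in vs ->
  index v vs \in ball arcs s [:: index u vs] -> reach prel s u v.
Proof.
move=> uV vV /prel_ball[i]; rewrite inE => /eqP -> {i}.
by rewrite !nth_index.
Qed.

End Pattern.

Ltac neqs := repeat match goal with H : is_true (_ != _) |- _ => move/eqP: H => H end.
Ltac uniqs := neqs; rewrite /= ?inE ?negb_or; repeat (apply/andP; split); try done;
  try (apply/eqP => ?; congruence).
Ltac adjs := rewrite /=; repeat (apply/andP; split); try done;
  first [by apply/eqP; congruence | assumption | by apply: edge_sym; assumption].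

(** Nodes have the numbers below [k], the [j]-th port has number [k + j] and belongs to node
    [nth 0 os j]. The last condition makes every spoke of the pattern oriented. *)
Definition parcs k (os : seq nat) (arcs : seq (nat * nat)) :=
  [&& all (fun a => (a.1 < k + size os) && (a.2 < k + size os)) arcs,
      all (fun a => (a.2, a.1) \notin arcs) arcs,
      all (fun o => o < k) os
    & all (fun j => ((k + j, nth 0 os j) \in arcs) || ((nth 0 os j, k + j) \in arcs))
        (iota 0 (size os))].

Definition pdist k (os : seq nat) arcs (f : nat -> nat -> nat) :=
  all (fun i => all (fun j => j \in ball arcs (f i j) [:: i]) (iota 0 (k + size os)))
    (iota 0 (k + size os)).

Section Blocks.
Variable I : inst.
Local Notation E := (iE I).
Local Notation N := (iN I).
Local Notation L := (iL I).
Local Notation V := (N + L)%type.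

Section Pat.
Variables (n0 : N) (ns : seq N) (ls : seq L) (os : seq nat) (arcs : seq (nat * nat)).
Hypotheses (uns : uniq ns) (uls : uniq ls).
Hypothesis osE : map (@own I) ls = map (nth n0 ns) os.
Local Notation vs := (map inl ns ++ map inr ls : seq V).
Hypothesis adjs : all (fun a => adjI (nth (inl n0) vs a.1) (nth (inl n0) vs a.2)) arcs.
Hypothesis chk : parcs (size ns) os arcs.
Local Notation DS := [set n in ns].
Local Notation XS := [set l in ls].
Local Notation a := (prel vs arcs).

Let sls : size ls = size os.
Proof. by have := congr1 size osE; rewrite !size_map. Qed.

Let svs : size vs = size ns + size os.
Proof. by rewrite size_cat !size_map sls. Qed.

Let uvs : uniq vs.
Proof.
rewrite cat_uniq !map_inj_uniq; try by move=> ? ? [].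
rewrite uns uls andbT; apply/hasP => -[x /mapP[l _ ->]] /mapP[] //.
Qed.

Let alt : all (fun a => (a.1 < size vs) && (a.2 < size vs)) arcs.
Proof. by rewrite svs; case/and4P: chk. Qed.

Lemma pat_inS u : inS DS XS u = (u \in vs).
Proof.
case: u => [n|l] /=; rewrite inE mem_cat.
  rewrite mem_map; last by move=> ? ? [].
  by case: (boolP (inl n \in map inr ls)) => [/mapP[]//|_]; rewrite orbF.
rewrite (mem_map (f := inr)); last by move=> ? ? [].
by case: (boolP (inr l \in map inl ns)) => //= /mapP[].
Qed.

Lemma pat_own l : l \in XS -> own l \in DS.
Proof.
rewrite !inE => /(map_f (@own I)); rewrite osE => /mapP[o oin ->].
by apply: mem_nth; case/and4P: chk => _ _ /allP/(_ _ oin).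
Qed.

Lemma pat_sub u v : a u v -> [/\ adjI u v, inS DS XS u & inS DS XS v].
Proof.
rewrite !pat_inS => /(prel_in (inl n0) alt)[i [j [ij -> -> -> ->]]].
by have := allP adjs _ ij.
Qed.

Lemma pat_anti u v : a u v -> ~~ a v u.
Proof. by rewrite /prel /= => ij; case/and4P: chk => _ /allP/(_ _ ij). Qed.

Lemma pat_spoke l : l \in XS -> spoked a l.
Proof.
rewrite inE => lin; have jl : index l ls < size ls by rewrite index_mem.
have ownE : own l = nth n0 ns (nth 0 os (index l ls)).
  have := congr1 (fun s => nth n0 s (index l ls)) osE.
  by rewrite (nth_map l) // nth_index // (nth_map 0) -?sls.
have vl : inr l = nth (inl n0) vs (size ns + index l ls).
  rewrite nth_cat size_map ltnNge leq_addr /= addnC addnK (nth_map l) //.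
  by rewrite nth_index.
have vo : inl (own l) = nth (inl n0) vs (nth 0 os (index l ls)).
  have oin : nth 0 os (index l ls) < size ns.
    case/and4P: chk => _ _ /allP h _; apply: h; apply: mem_nth.
    by rewrite -sls.
  by rewrite nth_cat size_map oin (nth_map n0) // ownE.
rewrite /spoked vl vo.
case/and4P: chk => _ _ _ /allP/(_ (index l ls)).
rewrite mem_iota add0n -sls jl => /(_ isT)/orP[h|h].
  by rewrite (prel_nth (inl n0) uvs alt h).
by rewrite (prel_nth (inl n0) uvs alt h) orbT.
Qed.

Lemma pat_reach f u v : pdist (size ns) os arcs f -> inS DS XS u -> inS DS XS v ->
  reach a (f (index u vs) (index v vs)) u v.
Proof.
rewrite !pat_inS => /allP h uV vV; apply: (prel_reach (inl n0) uvs alt) => //.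
have := h (index u vs); rewrite mem_iota add0n -svs index_mem uV => /(_ isT)/allP.
by apply; rewrite mem_iota add0n index_mem.
Qed.

Lemma pat_index u : inS DS XS u -> (size ns <= index u vs) = (if u is inr _ then true else false).
Proof.
case: u => [n|l]; rewrite /= inE => hin; rewrite index_cat.
  rewrite mem_map ?hin; last by move=> ? ? [].
  rewrite index_map; last by move=> ? ? [].
  by rewrite leqNgt index_mem hin.
case: (boolP (inr l \in map inl ns)) => [/mapP[] //|_].
by rewrite size_map leq_addr.
Qed.

Lemma pattern_good : 1 < size ns ->
  pdist (size ns) os arcs
    (fun i j => (7 * (size ns - 1) + 2 * (size ns <= i) + 2 * (size ns <= j))./2) ->
  good I.
Proof.
move=> k2 di; have cD : #|DS| = size ns by rewrite cardsE; apply/card_uniqP.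
exists DS, XS, a; split; rewrite ?cD //.
- exact: pat_own.
- exact: pat_sub.
- exact: pat_anti.
- exact: pat_spoke.
move=> u v uS vS; exists (7 * (size ns - 1) + wt u + wt v)./2; last by lia.
have := pat_reach di uS vS; rewrite !pat_index //.
by case: u v {uS vS} => [?|?] [?|?].
Qed.

End Pat.

(** A visit to [m] on the way from [b] to [a]. If it enters and leaves by the same port [y], the
    triangle [y], [m], [w] lets it turn round without reversing the spoke. *)
Definition arm (m : N) (b a : L) :=
  exists y y', [/\ own y = m, own y' = m, edge b y, edge y' a & y != y' \/ tri y].

(* The two shapes of a block between [n] and [m], seen from [n]: a cycle through two ports [a], [b]
   of [n], or a cycle through [m] hanging at a single port [p] whose triangle [p], [w], [n] reaches [n]. *)
Definition Pr (n m : N) (a b : L) := [/\ own a = n, own b = n, a != b & arm m b a].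
Definition Hg (n m : N) (p w : L) := [/\ own p = n, own w = n, edge p w
  & exists y y', [/\ own y = m, own y' = m, y != y', edge p y & edge y' p]].
Definition bport (n m : N) (l : L) := exists l', [\/ Pr n m l l', Hg n m l l' | Hg n m l' l].

Lemma arm_sym m a b : arm m a b -> arm m b a.
Proof.
move=> [y [y' [h1 h2 h3 h4 h5]]]; exists y', y; split=> //; try exact: edge_sym.
by have [e|ne] := eqVneq y' y; [right; case: h5; rewrite e ?eqxx|left].
Qed.

Lemma Pr_sym n m a b : Pr n m a b -> Pr n m b a.
Proof. by case=> ? ? ab ?; split; rewrite 1?eq_sym //; apply: arm_sym. Qed.

(** Seen from [m], two distinct arrival ports give the first shape again, and a single one with its
    triangle gives the hanging shape. This makes the block relation symmetric. *)
Lemma Pr_bport n m a b : Pr n m a b -> exists y y', [/\ bport m n y, bport m n y',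
  edge b y, edge y' a & [/\ own y = m, own y' = m & y != y' \/ tri y]].
Proof.
case=> an bn ab [y [y' [h1 h2 h3 h4 h5]]]; exists y, y'.
have [e|ne] := eqVneq y y'.
  case: h5 => [|[w wy yw]]; first by rewrite e eqxx.
  have bp : bport m n y.
    exists w; constructor 2; split=> //; first by rewrite wy.
    by exists a, b; split=> //; rewrite e.
  by rewrite -e in h4 *; split=> //; split=> //; right; exists w.
split=> //; last by split=> //; left.
  exists y'; constructor 1; split=> //; exists a, b; split=> //; last by left.
exists y; constructor 1; split; rewrite 1?eq_sym //.
exists b, a; split=> //; last by left; rewrite eq_sym.
all: exact: edge_sym.
Qed.

Lemma Hg_bport n m p w : Hg n m p w -> exists y y', [/\ bport m n y, bport m n y',
  edge p y, edge y' p & [/\ own y = m, own y' = m & y != y']].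
Proof.
case=> pn wn pw [y [y' [h1 h2 h3 h4 h5]]]; exists y, y'.
have tp : tri p by exists w; rewrite ?wn.
split=> //.
  exists y'; constructor 1; split=> //; exists p, p; split=> //; by right.
exists y; constructor 1; split; rewrite 1?eq_sym //; exists p, p; split=> //; try by right.
all: exact: edge_sym.
Qed.

Definition blk (n m : N) := n != m /\ exists l, bport n m l.

Lemma blk_sym n m : blk n m -> blk m n.
Proof.
case=> nm [l [l' h]]; split; first by rewrite eq_sym.
by case: h => [/Pr_bport|/Hg_bport|/Hg_bport] [y [y' [? _ _ _ _]]]; exists y.
Qed.

(** Both cycles are directed so as to use the shared spoke from [a] to [n]. Then [m1] and [m2] are 6
    arcs apart, or 7 with a triangle at the start, within the 14 doubled units of three nodes. If
    the second port is shared too, both visits are attached to the path [a], [n], [b1] as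
    gadgets. *)
Lemma share_PP n m1 m2 a b1 b2 : inst_ok I -> n != m1 -> n != m2 -> m1 != m2 ->
  Pr n m1 a b1 -> Pr n m2 a b2 -> good I.
Proof.
move=> ok nm1 nm2 m12 [an b1n ab1 [y1 [z1 [y1o z1o e1 f1 t1]]]] [_ b2n ab2 [y2 [z2 [y2o z2o e2 f2 t2]]]].
have [b12|b12] := eqVneq b1 b2.
  rewrite -{}b12 in e2 ab2.
  have g0 : gad [set n] a b1 by apply: gad_pass.
  have g1 : gad [set m1] y1 z1 by rewrite -y1o; apply: gad_unit => //; rewrite z1o.
  have g2 : gad [set m2] y2 z2 by rewrite -y2o; apply: gad_unit => //; rewrite z2o.
  have g01 : gad ([set n] :|: [set m1]) a b1.
    apply: (gad_join (cl := true) g0 g1) => //; last by rewrite !inE eqxx !orbT.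
      by rewrite disjoints1 inE.
    by move=> _; split=> // -[ba _]; rewrite ba eqxx in ab1.
  apply: (good_gad (Ns := ([set n] :|: [set m1]) :|: [set m2]) (a := a)).
    apply: (gad_join (cl := true) g01 g2) => //; last by rewrite !inE eqxx !orbT.
      rewrite disjoint_sym disjoints1 !inE negb_or.
      by rewrite eq_sym nm2 eq_sym m12.
    by move=> _; split=> // -[ba _]; rewrite ba eqxx in ab1.
  by rewrite -setUA cardsU1 cards2 !inE negb_or nm1 nm2 m12.
have [E1|D1] := eqVneq y1 z1; have [E2|D2] := eqVneq y2 z2.
- case: t1 => [|[w1 w1o yw1]]; first by rewrite E1 eqxx.
  case: t2 => [|[w2 w2o yw2]]; first by rewrite E2 eqxx.
  have yw1' : y1 != w1 by apply: contraTneq yw1 => <-; apply: edge_irr.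
  have yw2' : y2 != w2 by apply: contraTneq yw2 => <-; apply: edge_irr.
  rewrite -{}E1 in f1 z1o; rewrite -{}E2 in f2 z2o.
  apply: (@pattern_good n [:: n; m1; m2] [:: a; b1; b2; y1; w1; y2; w2] [:: 0; 0; 0; 1; 1; 2; 2] [:: (3,
    0); (0, 4); (0, 5); (4, 6); (6, 1); (1, 7); (7, 6); (6, 3); (5, 8); (8, 2); (2, 9); (9, 8); (8, 3)]);
    [by uniqs|by uniqs|by rewrite /= ?w1o ?w2o; congruence|by adjs|by vm_compute|by []|by vm_compute].
- case: t1 => [|[w1 w1o yw1]]; first by rewrite E1 eqxx.
  have yw1' : y1 != w1 by apply: contraTneq yw1 => <-; apply: edge_irr.
  rewrite -{}E1 in f1 z1o.
  apply: (@pattern_good n [:: n; m1; m2] [:: a; b1; b2; y1; w1; y2; z2] [:: 0; 0; 0; 1; 1; 2; 2] [:: (3,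
    0); (0, 4); (0, 5); (4, 6); (6, 1); (1, 7); (7, 6); (6, 3); (5, 8); (8, 2); (2, 9); (9, 3)]);
    [by uniqs|by uniqs|by rewrite /= ?w1o; congruence|by adjs|by vm_compute|by []|by vm_compute].
- case: t2 => [|[w2 w2o yw2]]; first by rewrite E2 eqxx.
  have yw2' : y2 != w2 by apply: contraTneq yw2 => <-; apply: edge_irr.
  rewrite -{}E2 in f2 z2o.
  apply: (@pattern_good n [:: n; m1; m2] [:: a; b1; b2; y1; z1; y2; w2] [:: 0; 0; 0; 1; 1; 2; 2] [:: (3,
    0); (0, 4); (0, 5); (4, 6); (6, 1); (1, 7); (7, 3); (5, 8); (8, 2); (2, 9); (9, 8); (8, 3)]);
    [by uniqs|by uniqs|by rewrite /= ?w2o; congruence|by adjs|by vm_compute|by []|by vm_compute].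
apply: (@pattern_good n [:: n; m1; m2] [:: a; b1; b2; y1; z1; y2; z2] [:: 0; 0; 0; 1; 1; 2; 2] [:: (3, 0);
  (0, 4); (0, 5); (4, 6); (6, 1); (1, 7); (7, 3); (5, 8); (8, 2); (2, 9); (9, 3)]);
  [by uniqs|by uniqs|by rewrite /=; congruence|by adjs|by vm_compute|by []|by vm_compute].
Qed.

Lemma share_P_hang n m1 m2 p b w : inst_ok I -> n != m1 -> n != m2 -> m1 != m2 ->
  Pr n m1 p b -> Hg n m2 p w -> good I.
Proof.
move=> ok nm1 nm2 m12 [pn bn pb [y1 [z1 [y1o z1o e1 f1 t1]]]] [_ wn pw [y2 [z2 [y2o z2o yz2 e2 f2]]]].
have g0 : gad [set n] p b by apply: gad_pass.
have g1 : gad [set m1] y1 z1 by rewrite -y1o; apply: gad_unit => //; rewrite z1o.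
have g2 : gad [set m2] y2 z2 by apply: gad_pass.
have g01 : gad ([set n] :|: [set m1]) p p.
  apply: (gad_join (cl := true) g0 g1) => //; last by rewrite !inE eqxx !orbT.
    by rewrite disjoints1 inE.
  by move=> _; split=> // -[ba _]; rewrite ba eqxx in pb.
apply: (good_gad (Ns := ([set n] :|: [set m1]) :|: [set m2]) (a := p)).
  apply: (gad_join (cl := true) g01 g2) => //; last by rewrite !inE eqxx !orbT.
    rewrite disjoint_sym disjoints1 !inE negb_or.
    by rewrite eq_sym nm2 eq_sym m12.
  by move=> _; split=> // -[_ ba]; rewrite ba eqxx in yz2.
by rewrite -setUA cardsU1 cards2 !inE negb_or nm1 nm2 m12.
Qed.

Lemma share_hang_hang n m1 m2 p w1 w2 : inst_ok I -> n != m1 -> n != m2 -> m1 != m2 ->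
  Hg n m1 p w1 -> Hg n m2 p w2 -> good I.
Proof.
move=> ok nm1 nm2 m12 [pn wn pw [y1 [z1 [y1o z1o yz1 e1 f1]]]] [_ _ _ [y2 [z2 [y2o z2o yz2 e2 f2]]]].
have g0 : gad [set n] p p by apply: (gad_tri ok pn wn).
have g1 : gad [set m1] y1 z1 by apply: gad_pass.
have g2 : gad [set m2] y2 z2 by apply: gad_pass.
have g01 : gad ([set n] :|: [set m1]) p p.
  apply: (gad_join (cl := true) g0 g1) => //; last by rewrite !inE eqxx !orbT.
    by rewrite disjoints1 inE.
  by move=> _; split=> // -[_ ba]; rewrite ba eqxx in yz1.
apply: (good_gad (Ns := ([set n] :|: [set m1]) :|: [set m2]) (a := p)).
  apply: (gad_join (cl := true) g01 g2) => //; last by rewrite !inE eqxx !orbT.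
    rewrite disjoint_sym disjoints1 !inE negb_or.
    by rewrite eq_sym nm2 eq_sym m12.
  by move=> _; split=> // -[_ ba]; rewrite ba eqxx in yz2.
by rewrite -setUA cardsU1 cards2 !inE negb_or nm1 nm2 m12.
Qed.

Lemma share_P_tip n m1 m2 a b p : inst_ok I -> n != m1 -> n != m2 -> m1 != m2 -> p != b ->
  Pr n m1 a b -> Hg n m2 p a -> good I.
Proof.
move=> ok nm1 nm2 m12 pb [an bn ab [y1 [z1 [y1o z1o e1 f1 t1]]]] [pn _ pa [y2 [z2 [y2o z2o yz2 e2 f2]]]].
have pa' : p != a by apply: contraTneq pa => <-; apply: edge_irr.
have [E1|D1] := eqVneq y1 z1.
  case: t1 => [|[w1 w1o yw1]]; first by rewrite E1 eqxx.
  have yw1' : y1 != w1 by apply: contraTneq yw1 => <-; apply: edge_irr.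
  rewrite -{}E1 in f1 z1o.
  apply: (@pattern_good n [:: n; m1; m2] [:: a; b; p; y1; w1; y2; z2] [:: 0; 0; 0; 1; 1; 2; 2] [:: (3, 0);
    (0, 4); (0, 5); (5, 3); (4, 6); (6, 1); (1, 7); (7, 6); (6, 3); (5, 8); (8, 2); (2, 9); (9, 5)]);
    [by uniqs|by uniqs|by rewrite /= ?w1o; congruence|by adjs|by vm_compute|by []|by vm_compute].
apply: (@pattern_good n [:: n; m1; m2] [:: a; b; p; y1; z1; y2; z2] [:: 0; 0; 0; 1; 1; 2; 2] [:: (3, 0);
  (0, 4); (0, 5); (5, 3); (4, 6); (6, 1); (1, 7); (7, 3); (5, 8); (8, 2); (2, 9); (9, 5)]);
  [by uniqs|by uniqs|by rewrite /=; congruence|by adjs|by vm_compute|by []|by vm_compute].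
Qed.

Lemma share_tip_tip n m1 m2 w p1 p2 : inst_ok I -> n != m1 -> n != m2 -> m1 != m2 -> p1 != p2 ->
  Hg n m1 p1 w -> Hg n m2 p2 w -> good I.
Proof.
move=> ok nm1 nm2 m12 p12 [p1n wn pw1 [y1 [z1 [y1o z1o yz1 e1 f1]]]] [p2n _ pw2 [y2 [z2 [y2o z2o yz2 e2
  f2]]]].
have p1w : p1 != w by apply: contraTneq pw1 => <-; apply: edge_irr.
have p2w : p2 != w by apply: contraTneq pw2 => <-; apply: edge_irr.
apply: (@pattern_good n [:: n; m1; m2] [:: w; p1; p2; y1; z1; y2; z2] [:: 0; 0; 0; 1; 1; 2; 2] [:: (3, 0);
  (0, 4); (0, 5); (4, 3); (5, 3); (4, 6); (6, 1); (1, 7); (7, 4); (5, 8); (8, 2); (2, 9); (9, 5)]);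
  [by uniqs|by uniqs|by rewrite /=; congruence|by adjs|by vm_compute|by []|by vm_compute].
Qed.

Lemma share_hang_tip n m1 m2 p1 w p2 : inst_ok I -> n != m1 -> n != m2 -> m1 != m2 ->
  Hg n m1 p1 w -> Hg n m2 p2 p1 -> good I.
Proof.
move=> ok nm1 nm2 m12 [p1n wn pw1 [y1 [z1 [y1o z1o yz1 e1 f1]]]] [p2n _ pw2 [y2 [z2 [y2o z2o yz2 e2 f2]]]].
have p12 : p2 != p1 by apply: contraTneq pw2 => <-; apply: edge_irr.
apply: (@pattern_good n [:: n; m1; m2] [:: p1; p2; y1; z1; y2; z2] [:: 0; 0; 1; 1; 2; 2] [:: (3, 0); (0,
  4); (4, 3); (3, 5); (5, 1); (1, 6); (6, 3); (4, 7); (7, 2); (2, 8); (8, 4)]);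
  [by uniqs|by uniqs|by rewrite /=; congruence|by adjs|by vm_compute|by []|by vm_compute].
Qed.

(** Without a good piece a port determines the neighbour to which its blocks lead. Hence blocks of
    the tree with different far ends meet in nodes only, and their orientations are independent. *)
Lemma bport_inj n m1 m2 l : inst_ok I -> ~ good I -> n != m1 -> n != m2 ->
  bport n m1 l -> bport n m2 l -> m1 = m2.
Proof.
move=> ok ng nm1 nm2 [l1 h1] [l2 h2]; apply/eqP/contraT => m12; case: ng.
have m21 : m2 != m1 by rewrite eq_sym.
have PT n' m m' a b p : n' != m -> n' != m' -> m != m' -> Pr n' m a b -> Hg n' m' p a -> good I.
  move=> h3 h4 h5 h6 h7; have [e|ne] := eqVneq p b; last exact: (share_P_tip ok h3 h4 h5 ne h6 h7).
  by rewrite e in h7; apply: (share_P_hang ok h3 h4 h5 (Pr_sym h6) h7).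
case: h1 => h1; case: h2 => h2.
- exact: (share_PP ok nm1 nm2 m12 h1 h2).
- exact: (share_P_hang ok nm1 nm2 m12 h1 h2).
- exact: (PT _ _ _ _ _ _ nm1 nm2 m12 h1 h2).
- exact: (share_P_hang ok nm2 nm1 m21 h2 h1).
- exact: (share_hang_hang ok nm1 nm2 m12 h1 h2).
- exact: (share_hang_tip ok nm1 nm2 m12 h1 h2).
- exact: (PT _ _ _ _ _ _ nm2 nm1 m21 h2 h1).
- exact: (share_hang_tip ok nm2 nm1 m21 h2 h1).
- have [e|ne] := eqVneq l1 l2; last exact: (share_tip_tip ok nm1 nm2 m12 ne h1 h2).
  by rewrite -e in h2; apply: (share_hang_hang ok nm1 nm2 m12 h1 h2).
Qed.

End Blocks.

(** * Connectedness of the block graph *)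

Section Passes.
Variable I : inst.
Local Notation E := (iE I).
Local Notation N := (iN I).
Local Notation L := (iL I).
Local Notation V := (N + L)%type.
Hypothesis ok : inst_ok I.
Hypothesis ng : ~ good I.

Definition blkb : rel N := [rel n m | `[< blk n m >]].

Lemma blkbP n m : reflect (blk n m) (blkb n m).
Proof. exact: asboolP. Qed.

Lemma blkb_sym : connect_sym blkb.
Proof. by apply: sym_connect_sym => n m; apply/blkbP/blkbP; apply: blk_sym. Qed.

Definition crossed n m (u v : L) :=
  [/\ own u = n, own v = m, edge u v, bport n m u & bport m n v].

(** A block leaves [n] through two different ports, or through one port lying in a triangle. So a
    prescribed port [a] at [n] can always be linked to one of the crossings by [gad_unit]. *)
Lemma blk_edge (n m : N) (a : L) : blk n m -> exists u v, crossed n m u v /\ (u != a \/ tri a).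
Proof.
case=> nm [l [l' h]].
have HH p w : Hg n m p w -> exists u v, crossed n m u v /\ (u != a \/ tri a).
  move=> hg; have [y [y' [b1 b2 e1 e2 [o1 o2 yy]]]] := Hg_bport hg.
  have [pn wn pw _] := hg; exists p, y; split.
    by split=> //; exists w; constructor 2.
  by have [<-|?] := eqVneq p a; [right; exists w; rewrite ?wn|left].
case: h => [h|h|h]; [|exact: HH h|exact: HH h].
have [y [y' [b1 b2 e1 e2 [o1 o2 yy]]]] := Pr_bport h.
have [an bn ab _] := h; have [e|ne] := eqVneq l' a.
  exists l, y'; split; last by left; rewrite -e.
  by split=> //; [exact: edge_sym|exists l'; constructor 1].
exists l', y; split; last by left.
by split=> //; exists l; constructor 1; apply: Pr_sym.
Qed.

(** Now both ends are prescribed. This fails only if [a] and [b] lie on different crossings of a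
    block with two distinct ports at each end; then its whole cycle, closed, is a gadget from [a] to
    [b]. *)
Lemma blk_edge2 (n m : N) (a b : L) : blk n m -> own a = n -> own b = m ->
  (exists u v, [/\ crossed n m u v, u != a \/ tri a & v != b \/ tri b])
  \/ gad ([set n] :|: [set m]) a b.
Proof.
case=> nm [l [l' h]] ao bo.
have HH p w : Hg n m p w -> exists u v, [/\ crossed n m u v, u != a \/ tri a & v != b \/ tri b].
  move=> hg; have [y [y' [b1 b2 e1 e2 [o1 o2 yy]]]] := Hg_bport hg.
  have [pn wn pw _] := hg.
  have pa : p != a \/ tri a by have [<-|?] := eqVneq p a; [right; exists w; rewrite ?wn|left].
  have bp : bport n m p by exists w; constructor 2.
  have [e|ne] := eqVneq y b.
    exists p, y'; split=> //; last by left; rewrite -e eq_sym.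
    by split=> //; apply: edge_sym.
  by exists p, y; split=> //; left.
case: h => [h|h|h]; [|by left; exact: HH h|by left; exact: HH h].
have [y [y' [b1 b2 e1 e2 [o1 o2 yy]]]] := Pr_bport h.
have [an bn ab _] := h.
have c1 : crossed n m l' y.
  by split=> //; exists l; constructor 1; apply: Pr_sym.
have c2 : crossed n m l y'.
  by split=> //; [exact: edge_sym|exists l'; constructor 1].
have [yE|yD] := eqVneq y y'.
  have yb : y != b \/ tri b.
    by have [<-|?] := eqVneq y b; [right; case: yy; rewrite ?yE ?eqxx|left].
  left; have [e|ne] := eqVneq l' a.
    by exists l, y'; split=> //; [left; rewrite -e|rewrite -yE].
  by exists l', y; split=> //; left.
have dj : [disjoint [set n] & [set m]] by rewrite disjoints1 inE.
have [ea|na] := eqVneq l' a.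
  have [eb|nb] := eqVneq y' b; last by left; exists l, y'; split=> //; left; rewrite // -ea.
  right; rewrite -ea -eb.
  have g1 : gad [set n] l' l by apply: gad_pass; rewrite // eq_sym.
  have g2 : gad [set m] y' y by apply: gad_pass; rewrite // eq_sym.
  apply: (gad_join (cl := true) g1 g2 dj); first exact: edge_sym.
    move=> _; split; first exact: edge_sym.
    by case=> e; rewrite e eqxx in ab.
  by rewrite !inE eqxx !orbT.
have [eb|nb] := eqVneq y b; last by left; exists l', y; split=> //; left.
have [ea|na'] := eqVneq l a; last first.
  by left; exists l, y'; split=> //; left; rewrite // -eb eq_sym.
right; rewrite -ea -eb.
have g1 : gad [set n] l l' by apply: gad_pass.
have g2 : gad [set m] y y' by apply: gad_pass.
apply: (gad_join (cl := true) g1 g2 dj) => //; last by rewrite !inE eqxx !orbT.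
move=> _; split=> //.
by case=> e; rewrite e eqxx in ab.
Qed.

(** Unless [a] is a port of the given block already, the edge from [a] to [z] and one crossing of
    that block form a cycle through [a]. *)
Lemma linked_Pr (n m : N) (a z : L) : blk n m -> own a = n -> own z = m -> edge a z -> ~ tri a ->
  exists g, Pr n m a g.
Proof.
case=> nm [l [l' h]] ao zo az nt.
have HH p w : Hg n m p w -> exists g, Pr n m a g.
  move=> hg; have [y [y' [b1 b2 e1 e2 [o1 o2 yy]]]] := Hg_bport hg.
  have [pn wn pw _] := hg.
  have ap : a != p by apply/eqP => e; apply: nt; exists w; rewrite e ?wn.
  exists p; split=> //; have [e|ne] := eqVneq y z.
    exists y', z; split=> //; try exact: edge_sym.
    by left; rewrite -e eq_sym.
  by exists y, z; split=> //; [exact: edge_sym|left].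
case: h => [h|h|h]; [|exact: HH h|exact: HH h].
have [y [y' [b1 b2 e1 e2 [o1 o2 yy]]]] := Pr_bport h.
have [an bn ab _] := h.
have [->|al] := eqVneq a l; first by exists l'.
have [->|al'] := eqVneq a l'; first by exists l; apply: Pr_sym.
have [e|ne] := eqVneq y z; last first.
  by exists l'; split=> //; exists y, z; split=> //; [exact: edge_sym|left].
case: yy => yy.
  exists l; split=> //; exists y', z; split=> //; try exact: edge_sym.
  by left; rewrite -e eq_sym.
by exists l'; split=> //; exists y, z; split=> //; [exact: edge_sym|right].
Qed.

Lemma set_in_cons (x : N) s : [set z in x :: s] = [set x] :|: [set z in s].
Proof. by apply/setP => z; rewrite !inE. Qed.

(** The entry port lies in a block towards [x], off the path, so by [bport_inj] it is no port of the
    block towards the next node. Every turn but the last is therefore a plain passage between two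
    distinct ports; only at [b] may a triangle be used. *)
Lemma gad_chain rest (n x : N) (a b : L) : own a = n -> bport n x a -> n != x -> x \notin rest ->
  uniq (n :: rest) -> path blkb n rest -> rest != [::] -> own b = last n rest ->
  gad [set z in n :: rest] a b.
Proof.
elim: rest n x a => [|m rest IH] n x a // ao ax nx xr ur pr _ bl.
have nmr : n \notin m :: rest by case/andP: ur.
have nb : blk n m by move: pr => /= /andP[/blkbP].
have nm : n != m by case: nb.
have dj : [disjoint [set n] & [set z in m :: rest]] by rewrite disjoints1 inE.
have ua u : bport n m u -> a != u.
  move=> bu; apply: contraNneq xr => e; rewrite -e in bu.
  by rewrite (bport_inj ok ng nx nm ax bu) mem_head.
case: rest => [|m' rest] in IH pr ur bl xr nmr dj *.
  have [v [u [[h1 h2 h3 h4 h5] h6]]] := blk_edge b (blk_sym nb).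
  have g1 : gad [set n] a u by apply: gad_pass => //; apply: ua.
  have g2 : gad [set m] v b.
    rewrite -h1; apply: gad_unit => //; first by rewrite bl.
    by have [e|ne] := eqVneq v b; [right; case: h6; rewrite e ?eqxx|left].
  have {}g2 : gad [set z in [:: m]] v b.
    by rewrite (_ : [set z in [:: m]] = [set m]) //; apply/setP => z; rewrite !inE.
  by rewrite set_in_cons; apply: (gad_join (cl := false) g1 g2 dj (edge_sym h3)); rewrite ?eqxx.
have [u [v [[h1 h2 h3 h4 h5] _]]] := blk_edge a nb.
have g1 : gad [set n] a u by apply: gad_pass => //; apply: ua.
have g2 : gad [set z in [:: m, m' & rest]] v b.
  apply: (IH m n v) => //.
  - by rewrite eq_sym.
  - by move: nmr; rewrite inE negb_or => /andP[].
  - by case/andP: ur.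
  - by case/andP: pr.
by rewrite set_in_cons; apply: (gad_join (cl := false) g1 g2 dj h3); rewrite ?eqxx.
Qed.

(** The delicate case is [a = b] without a triangle at [a]. If [z] belongs to a node next to
    [own a], [linked_Pr] provides a closed gadget on two nodes. If [z] is farther away, the path of
    blocks closed by the edge between [z] and [a] is a gadget on at least three nodes, against
    [ng]. *)
Lemma pass (a b : L) : connect blkb (own a) (own b) ->
  a != b \/ (exists2 z, edge a z & connect blkb (own a) (own z)) ->
  exists Ns, [/\ gad Ns a b, forall x, x \in Ns -> connect blkb (own a) x
   & 1 < #|Ns| \/ [/\ Ns = [set own a], own a = own b & a != b \/ tri a]].
Proof.
move=> cab hab.
have unit_case : own a = own b -> a != b \/ tri a -> exists Ns, [/\ gad Ns a b, forall x, x \in Ns ->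
  connect blkb (own a) x
   & 1 < #|Ns| \/ [/\ Ns = [set own a], own a = own b & a != b \/ tri a]].
  move=> oo tt; exists [set own a]; split; first exact: gad_unit.
    by move=> x; rewrite inE => /eqP ->.
  by right.
have card2 (n : N) r (m : N) : n \notin m :: r -> 1 < #|[set z in n :: m :: r]|.
  move=> nr; rewrite set_in_cons cardsU1 inE nr -[1]addn0 ltn_add2l.
  by apply/card_gt0P; exists m; rewrite !inE eqxx.
have sub n r : path blkb n r -> forall x, x \in [set z in n :: r] -> connect blkb n x.
  by move=> pr x; rewrite inE; apply: (path_connect pr).
have [oab|oab] : own a = own b \/ own a != own b by case: (eqVneq (own a) (own b)); [left|right].
  have [ab|ab] : a = b \/ a != b by case: (eqVneq a b); [left|right].
    2: by apply: unit_case => //; left.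
  have [ta|ta] := pselect (tri a); first by apply: unit_case => //; right.
  case: hab => [|[z az caz]]; first by rewrite ab eqxx.
  rewrite -{b}ab in oab cab unit_case *.
  have naz : own z <> own a by move=> e; apply: ta; exists z.
  case/connectP: caz => p0 /shortenP[p pp up _] pl.
  case: p pp up pl => [|m r] pp up pl; first by case: naz.
  have nb : blk (own a) m by move: pp => /= /andP[/blkbP].
  have nm : own a != m by case: nb.
  have nmr : own a \notin m :: r by case/andP: up.
  case: r => [|m' r] in pp up pl nmr *.
    have [g [_ go ag [y [y' [h1 h2 h3 h4 h5]]]]] := linked_Pr nb erefl pl az ta.
    exists ([set own a] :|: [set m]); split.
    - have g1 : gad [set own a] a g by apply: gad_pass.
      have g2 : gad [set m] y y' by rewrite -h1; apply: gad_unit; rewrite // h2.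
      apply: (gad_join (cl := true) g1 g2) => //; last by rewrite !inE eqxx !orbT.
        by rewrite disjoints1 inE.
      by move=> _; split=> // -[e]; rewrite e eqxx in ag.
    - move=> x; rewrite !inE => /orP[] /eqP -> //.
      by apply: connect1; apply/blkbP.
    - by left; rewrite cards2 nm.
  have [u [v [[h1 h2 h3 h4 h5] h6]]] := blk_edge a nb.
  case: ng; apply: (good_gad (Ns := [set own a] :|: [set z in m :: m' :: r]) (a := a)).
    have g1 : gad [set own a] a u.
      apply: gad_unit => //; case: h6; last by right.
      by rewrite eq_sym; left.
    have g2 : gad [set z in m :: m' :: r] v z.
      apply: (gad_chain (x := own a)) => //.
      - by rewrite eq_sym.
      - by move: nmr; rewrite inE negb_or => /andP[].
      - by case/andP: up.
      - by case/andP: pp.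
    apply: (gad_join (cl := true) g1 g2) => //; last by rewrite !inE eqxx !orbT.
      by rewrite disjoints1 inE.
    move=> _; split; first exact: edge_sym.
    case=> _ vz; case/andP: up => _ /andP[+ _].
    by rewrite -h2 vz pl /= mem_last.
  rewrite cardsU1 inE nmr add1n ltnS; apply: card2.
  by case/andP: up => _ /andP[].
case/connectP: cab => p0 /shortenP[p pp up _] pl.
case: p pp up pl => [|m r] pp up pl; first by rewrite pl eqxx in oab.
have nb : blk (own a) m by move: pp => /= /andP[/blkbP].
have nm : own a != m by case: nb.
have nmr : own a \notin m :: r by case/andP: up.
exists [set z in own a :: m :: r]; split; [|exact: sub|by left; apply: card2].
have ua u : u != a \/ tri a -> a != u \/ tri a by rewrite eq_sym.
rewrite set_in_cons; case: r => [|m' r] in pp up pl nmr *.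
  have [[u [v [[h1 h2 h3 h4 h5] h6 h7]]]|] := blk_edge2 nb erefl pl; last first.
    by rewrite (_ : [set z in [:: m]] = [set m]) //; apply/setP => z; rewrite !inE.
  have g1 : gad [set own a] a u by apply: gad_unit => //; apply: ua.
  have g2 : gad [set z in [:: m]] v b.
    rewrite (_ : [set z in [:: m]] = [set own v]); last by apply/setP => z; rewrite !inE h2.
    apply: gad_unit => //; first by rewrite h2 pl.
    by have [e|ne] := eqVneq v b; [right; case: h7; rewrite e ?eqxx|left].
  apply: (gad_join (cl := false) g1 g2 _ h3); rewrite ?eqxx //.
  by rewrite disjoints1 inE.
have [u [v [[h1 h2 h3 h4 h5] h6]]] := blk_edge a nb.
have g1 : gad [set own a] a u by apply: gad_unit => //; apply: ua.
have g2 : gad [set z in m :: m' :: r] v b.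
  apply: (gad_chain (x := own a)) => //.
  - by rewrite eq_sym.
  - by move: nmr; rewrite inE negb_or => /andP[].
  - by case/andP: up.
  - by case/andP: pp.
apply: (gad_join (cl := false) g1 g2 _ h3); rewrite ?eqxx //.
by rewrite disjoints1 inE.
Qed.

Let nu (e : E) b := root blkb (own (pi e b)).
Definition loopy (l : L) := [exists d : E * bool, (pi d.1 d.2 == l) && (nu d.1 d.2 == nu d.1 (~~ d.2))].
(* The class of a dart is its port, unless the port also has an edge inside its component. *)
Let ka (e : E) b : (L + E * bool)%type :=
  if loopy (pi e b) then inr (e, b) else inl (pi e b).
Local Notation ts d := (pi d.1 d.2).
Local Notation hs d := (pi d.1 (~~ d.2)).

Lemma rootE n m : (root blkb n == root blkb m) = connect blkb n m.
Proof. exact: root_connect blkb_sym n m. Qed.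

Lemma ka_nu e b e' b' : ka e b = ka e' b' -> nu e b = nu e' b'.
Proof.
rewrite /ka; case: ifP => _; case: ifP => _ //; first by case=> -> ->.
by rewrite /nu => -[->].
Qed.

(** Pulled back to nodes, a class cut is a cut of the instance. If the class is a single dart,
    [ok_edge] excludes it. If it is a whole port, no edge of this port stays within its component,
    so the cut consists of all its edges and [ok_spoke] applies. *)
Lemma no_class_cut (A : {set N}) x : dtl nu x \notin A -> dhd nu x \in A ->
  ~ (forall y, dtl nu y != dhd nu y ->
       (dtl nu y \notin A) && (dhd nu y \in A) = (ktl ka y == ktl ka x)).
Proof.
move=> xA hA H; pose B := [set n | root blkb n \in A].
have crE y : crossing B y = (dtl nu y \notin A) && (dhd nu y \in A).
  by rewrite /crossing !inE.
have crE2 y : crossing B y = (dtl nu y != dhd nu y) && (ktl ka y == ktl ka x).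
  rewrite crE; case: (eqVneq (dtl nu y) (dhd nu y)) => [->|ne] /=; last exact: H.
  by rewrite andNb.
have xne : dtl nu x != dhd nu x by apply: contraNneq xA => ->.
case: (boolP (loopy (ts x))) => lx.
  apply: (ok_edge ok (A := B) (d := x)) => y; rewrite crE2.
  apply/andP/eqP => [[_ /eqP]|->]; last by rewrite xne eqxx.
  rewrite /ktl /ka lx; case: ifP => // _ [].
  by case: y x {xA hA H crE crE2 xne lx} => [? ?] [? ?] /= -> ->.
apply: (ok_spoke ok (A := B) (l := ts x)).
- by apply/set0Pn; exists (own (hs x)); rewrite inE.
- by rewrite inE.
move=> y; rewrite crE2; apply/andP/eqP => [[_ /eqP]|yx].
  by rewrite /ktl /ka (negbTE lx); case: ifP => // _ [].
split; last by rewrite /ktl /ka yx (negbTE lx).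
apply: contra lx => e; apply/existsP; exists y; rewrite yx eqxx /=; exact: e.
Qed.

Lemma edge_dart (d : E * bool) : edge (ts d) (hs d).
Proof. by apply/existsP; exists d; rewrite !eqxx. Qed.

(** If both darts use the same port, their classes can differ only because the port has an edge
    inside its component; this is the edge that [pass] requires. *)
Lemma dart_pass d d' : pstep nu ka d d' -> exists Ns, [/\ gad Ns (hs d) (ts d'),
  forall x, x \in Ns -> root blkb x = dhd nu d
  & 1 < #|Ns| \/ [/\ Ns = [set own (hs d)], own (hs d) = own (ts d') & hs d != ts d' \/ tri (hs d)]].
Proof.
case/andP=> e1 k1.
have [||Ns [h1 h2 h3]] := @pass (hs d) (ts d').
- by rewrite -rootE; exact: e1.
- have [e|ne] := eqVneq (hs d) (ts d'); last by left.
  right; move: k1; rewrite /khd /ktl /ka -e; case: ifP => [lo _|]; last by rewrite eqxx.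
  case/existsP: lo => d2 /andP[/eqP t2 l2]; exists (hs d2); first by rewrite -t2 edge_dart.
  by rewrite -rootE -t2; exact: l2.
exists Ns; split=> // x /h2; rewrite -rootE => /eqP <-; by [].
Qed.

Lemma gad_ne Ns (a b : L) : gad Ns a b -> own a \in Ns.
Proof. by case=> Vg [ag g]; apply: (g_home g (g_a g)). Qed.

Lemma dart_series s d : s != [::] -> path (pstep nu ka) d s -> uniq (map (dhd nu) (belast d s)) ->
  exists Ns, [/\ gad Ns (hs d) (ts (last d s)),
  forall x, x \in Ns -> root blkb x \in map (dhd nu) (belast d s)
  & 1 < #|Ns| \/ exists d', [/\ s = [:: d'], Ns = [set own (hs d)],
    own (hs d) = own (ts d') & hs d != ts d' \/ tri (hs d)]].
Proof.
elim: s d => [|d' s IH] d // _ /= /andP[dd pp] /andP[nin uu].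
have [N1 [g1 r1 c1]] := dart_pass dd.
case: s => [|d2 s] in IH pp nin uu *.
  exists N1; split=> //; first by move=> x /r1 ->; rewrite mem_head.
  by case: c1 => [|[]]; [left|right; exists d'].
have [N2 [g2 r2 c2]] := IH d' isT pp uu.
have dj : [disjoint N1 & N2].
  apply/pred0P => x /=; apply/negP => /andP[/r1 h /r2]; rewrite h.
  by move=> k; move: nin; rewrite k.
exists (N1 :|: N2); split.
- by apply: (gad_join (cl := false) g1 g2 dj (edge_dart _)); rewrite ?eqxx.
- by move=> x; rewrite in_setU in_cons => /orP[/r1 ->|/r2 ->]; rewrite ?eqxx ?orbT.
left; rewrite cardsU (disjoint_setI0 dj) cards0 subn0.
have p1 : 0 < #|N1| by apply/card_gt0P; exists (own (hs d)); apply: gad_ne g1.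
have p2 : 0 < #|N2| by apply/card_gt0P; exists (own (hs d')); apply: gad_ne g2.
by lia.
Qed.

(** A proper cycle through the components becomes a closed gadget. With three nodes or more it is a
    good piece. Otherwise it has two darts and one node in each of two components, so it is a block
    joining them, which is absurd. *)
Lemma blk_connected n m : connect blkb n m.
Proof.
apply: contrapT => /negP nc.
have [d dc] : exists d, crossing [set x | connect blkb n x] d.
  apply: (ok_conn ok).
    by apply/set0Pn; exists n; rewrite inE connect0.
  by apply: contraNneq nc => /setP/(_ m); rewrite !inE.
have dl : dtl nu d != dhd nu d.
  case/andP: dc; rewrite !inE => h1 h2; rewrite /dtl /dhd /nu rootE.
  by apply: contra h1 => h1; apply: connect_trans h2 _; rewrite blkb_sym.
have [c /and3P[cyc ud sz]] := proper_cycle_exists ka_nu no_class_cut (ex_intro _ d dl).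
case: c cyc ud sz => [|d1 s] //= cyc ud; rewrite ltnS => sz.
move: cyc; rewrite rcons_path => /andP[pp pl].
have sn : s != [::] by case: s sz {pp pl ud}.
have ud2 : uniq (dtl nu d1 :: map (dhd nu) (belast d1 s)) by rewrite -(map_dtl_belast pp).
have [N2 [g2 r2 c2]] := dart_series sn pp (proj2 (andP ud2)).
have [N1 [g1 r1 c1]] := dart_pass pl.
have dlE : dhd nu (last d1 s) = dtl nu d1 by case/andP: pl => /eqP.
have dj : [disjoint N1 & N2].
  apply/pred0P => x /=; apply/negP => /andP[/r1 h /r2]; rewrite h dlE.
  by move=> k; case/andP: ud2; rewrite k.
(* Otherwise the two darts are one edge run in both directions, and they have the same class at the
   turn, against [pstep]. *)
have nbs : ~ (ts d1 = hs (last d1 s) /\ hs d1 = ts (last d1 s)).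
  set d' := last d1 s in pl *; case=> q1 q2.
  have := @ok_simple _ ok d1.1 d1.2 d'.1 (~~ d'.2) q1; rewrite negbK => /(_ q2) ee.
  case/andP: pl => _ /eqP; apply; rewrite /khd /ktl -ee.
  have [->//|ne] := eqVneq d1.2 (~~ d'.2).
  case: (@ok_irr _ ok d1.1 d1.2); rewrite q2 -ee.
  by congr (pi _ _); case: (d1.2) (d'.2) ne => [] [].
have p1 : 0 < #|N1| by apply/card_gt0P; exists (own (hs (last d1 s))); apply: gad_ne g1.
have p2 : 0 < #|N2| by apply/card_gt0P; exists (own (hs d1)); apply: gad_ne g2.
have gg : gad (N1 :|: N2) (hs (last d1 s)) (hs (last d1 s)).
  apply: (gad_join (cl := true) g1 g2 dj (edge_dart _)); last by rewrite !inE eqxx !orbT.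
  by move=> _; split; [exact: edge_dart|].
have cc : #|N1 :|: N2| = #|N1| + #|N2|.
  by rewrite cardsU (disjoint_setI0 dj) cards0 subn0.
have small : 2 < #|N1 :|: N2| -> False by move=> k; apply: ng; apply: good_gad gg k.
case: c1 => [c1|[N1E o1 t1]]; first by apply: small; rewrite cc; lia.
case: c2 => [c2|[d' [sE N2E o2 t2]]]; first by apply: small; rewrite cc; lia.
subst s; rewrite /= in pl ud2 nbs o1 t1.
have nm : own (ts d1) != own (hs d1).
  case/andP: ud2 => + _; rewrite inE; apply: contra => /eqP e.
  by rewrite /dtl /dhd /nu e.
have b : blk (own (ts d1)) (own (hs d1)).
  split=> //; exists (hs d').
  have [e|ne] := eqVneq (hs d') (ts d1); last first.
    exists (ts d1); constructor 1; split=> //.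
    by exists (hs d1), (ts d'); split=> //; exact: edge_dart.
  case: t1 => [|[w wo ww]]; first by rewrite e eqxx.
  exists w; constructor 2; split=> //; first by rewrite wo.
  exists (hs d1), (ts d'); split=> //; try exact: edge_dart.
    by apply/eqP => e2; apply: nbs.
  by rewrite e; exact: edge_dart.
case/andP: ud2 => + _; rewrite inE => /eqP; apply; apply/eqP.
by rewrite /dtl /dhd /nu rootE; apply: connect1; apply/blkbP.
Qed.

End Passes.

(** * Trees of blocks *)

Section Tree.
Variable I : inst.
Local Notation E := (iE I).
Local Notation N := (iN I).
Local Notation L := (iL I).
Local Notation V := (N + L)%type.

Record oblk (n m : N) (XB : {set L}) (aB : rel V) (c1 c2 : nat) : Prop := OBlk {
  ob_bp : forall l, l \in XB -> own l = n /\ bport n m l \/ own l = m /\ bport m n l;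
  ob_sub : forall u v, aB u v -> [/\ adjI u v, inS [set x in [:: n; m]] XB u & inS [set x in [:: n; m]] XB v];
  ob_anti : forall u v, aB u v -> ~~ aB v u;
  ob_spoke : forall l, l \in XB -> spoked aB l;
  ob_12 : reach aB c1 (inl n) (inl m);
  ob_21 : reach aB c2 (inl m) (inl n);
  ob_all : forall u v, inS [set x in [:: n; m]] XB u -> inS [set x in [:: n; m]] XB v -> reach aB 5 u v }.

Lemma oblk_rev n m XB aB c1 c2 : oblk n m XB aB c1 c2 ->
  oblk n m XB (fun u v => aB v u) c2 c1.
Proof.
case=> h1 h2 h3 h4 h5 h6 h7; split=> //.
- by move=> u v /h2[/adjI_sym]; split.
- by move=> u v; apply: h3.
- by move=> l /h4; rewrite /spoked orbC.
- exact: (@reach_rev _ (fun u v => aB v u)).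
- exact: (@reach_rev _ (fun u v => aB v u)).
- by move=> u v hu hv; apply: (@reach_rev _ (fun u v => aB v u)); apply: h7.
Qed.

Definition bdist c1 c2 (i j : nat) :=
  if (i, j) == (0, 1) then c1 else if (i, j) == (1, 0) then c2 else 5.

Lemma pattern_oblk n m (ls : seq L) os arcs c1 c2 : n != m -> uniq ls ->
  map (@own I) ls = map (nth n [:: n; m]) os ->
  all (fun a => adjI (nth (inl n) (map inl [:: n; m] ++ map inr ls) a.1)
                     (nth (inl n) (map inl [:: n; m] ++ map inr ls) a.2)) arcs ->
  parcs 2 os arcs -> pdist 2 os arcs (bdist c1 c2) ->
  c1 <= 5 -> c2 <= 5 ->
  (forall l, l \in ls -> own l = n /\ bport n m l \/ own l = m /\ bport m n l) ->
  exists XB aB, oblk n m XB aB c1 c2.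
Proof.
move=> nm uls osE adjs chk di c15 c25 bp.
have uns : uniq [:: n; m] by rewrite /= inE nm.
have mS : inS [set x in [:: n; m]] [set l in ls] (inl m) by rewrite /= !inE eqxx orbT.
have nS : inS [set x in [:: n; m]] [set l in ls] (inl n) by rewrite /= !inE eqxx.
have re := pat_reach uns uls osE chk di.
have nE : index (inl n) (map inl [:: n; m] ++ map inr ls : seq V) = 0 by rewrite /= eqxx.
have mE : index (inl m) (map inl [:: n; m] ++ map inr ls : seq V) = 1.
  rewrite /= eqxx; case: eqP => // -[e]; by rewrite e eqxx in nm.
exists [set l in ls], (prel (map inl [:: n; m] ++ map inr ls) arcs); split.
- by move=> l; rewrite inE; apply: bp.
- by move=> *; eapply pat_sub; eassumption.
- by move=> *; eapply pat_anti; eassumption.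
- by move=> *; eapply pat_spoke; eassumption.
- by have := re _ _ nS mS; rewrite nE mE.
- by have := re _ _ mS nS; rewrite nE mE.
- move=> u v uS vS; apply: reach_le (re _ _ uS vS).
  by rewrite /bdist; case: ifP => // _; case: ifP.
Qed.

(** With two distinct ports at each end the block is a directed 6-cycle. A triangle at one end costs
    one more arc, in one direction only, and reversing all arcs moves this cost to the other
    direction. *)
Lemma blk_orient (n m : N) : inst_ok I -> blk n m ->
  (exists XB aB, oblk n m XB aB 3 3) \/
  (exists XB aB, oblk n m XB aB 3 4) /\ (exists XB aB, oblk n m XB aB 4 3).
Proof.
move=> ok [nm [l [l' h]]].
have rv c1 c2 : (exists XB aB, oblk n m XB aB c1 c2) -> exists XB aB, oblk n m XB aB c2 c1.
  by move=> [XB [aB /oblk_rev ob]]; exists XB; eexists; exact: ob.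
have HH p w : Hg n m p w -> exists XB aB, oblk n m XB aB 4 3.
  move=> hg; have [y [y' [b1 b2 e1 e2 [o1 o2 yy]]]] := Hg_bport hg.
  have [pn wn pw _] := hg.
  have pw' : p != w by apply: contraTneq pw => <-; apply: edge_irr.
  apply: (@pattern_oblk n m [:: p; w; y; y'] [:: 0; 0; 1; 1] [:: (2, 0); (0, 3); (3, 2); (2, 4); (4, 1);
    (1, 5); (5, 2)]);
   [by []|by uniqs|by rewrite /=; congruence|by adjs|by vm_compute|by vm_compute|by []|by []|].
  move=> z; rewrite !inE => /or4P[] /eqP ->; [left|left|by right|by right].
    by split=> //; exists w; constructor 2.
  by split=> //; exists p; constructor 3.
case: h => [h|h|h]; [|by right; split; [apply: rv|]; exact: HH h|by right; split; [apply: rv|]; exact: HH h].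
have [y [y' [b1 b2 e1 e2 [o1 o2 yy]]]] := Pr_bport h.
have [an bn ab _] := h.
have [E1|D1] := eqVneq y y'.
  case: yy => [|[w wo yw]]; first by rewrite E1 eqxx.
  have yw' : y != w by apply: contraTneq yw => <-; apply: edge_irr.
  rewrite -{}E1 in b2 e2 o2.
  have wm : own w = m by rewrite wo.
  suff H34 : exists XB aB, oblk n m XB aB 3 4 by right; split=> //; apply: rv.
  apply: (@pattern_oblk n m [:: l; l'; y; w] [:: 0; 0; 1; 1] [:: (0,3); (3,4); (4,1); (1,5); (5,4); (4,2);
    (2,0)]);
   [by []|by uniqs|by rewrite /=; congruence|by adjs|by vm_compute|by vm_compute|by []|by []|].
  move=> z; rewrite !inE => /or4P[] /eqP ->; [left|left|by right|right]; split=> //.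
  - by exists l'; constructor 1.
  - by exists l; constructor 1; apply: Pr_sym.
  - by exists y; constructor 3; split=> //; exists l, l'; split=> //; exact: edge_sym.
left; apply: (@pattern_oblk n m [:: l; l'; y; y'] [:: 0; 0; 1; 1] [:: (0,3); (3,4); (4,1); (1,5); (5,2);
  (2,0)]);
   [by []|by uniqs|by rewrite /=; congruence|by adjs|by vm_compute|by vm_compute|by []|by []|].
move=> z; rewrite !inE => /or4P[] /eqP ->; [left|left|by right|by right]; split=> //.
  by exists l'; constructor 1.
by exists l; constructor 1; apply: Pr_sym.
Qed.

(* The type [t] of a node shifts the doubled distances to it and from it in opposite directions. *)
Definition Pt (t : N -> bool) (u : V) : nat := if u is inl n then t n else 4.
Definition Qt (t : N -> bool) (u : V) : nat := if u is inl n then ~~ t n else 4.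

(** The [+ 1] matches [Pt t n + Qt t n = 1]: the condition is tight for a single node. *)
Record core (C : {set N}) (X : {set L}) (o : rel V) (t : N -> bool) : Prop := Core {
  co_own : forall l, l \in X -> own l \in C;
  co_sub : forall u v, o u v -> [/\ adjI u v, inS C X u & inS C X v];
  co_anti : forall u v, o u v -> ~~ o v u;
  co_spoke : forall l, l \in X -> spoked o l;
  co_dist : forall u v, inS C X u -> inS C X v ->
    exists2 s, reach o s u v & 2 * s + 1 <= 7 * (#|C| - 1) + Pt t v + Qt t u }.

(** Invariant of the growth that makes [bport_inj] applicable: a block leading out of [C] cannot
    reuse a port already present. *)
Definition bported (C : {set N}) (X : {set L}) :=
  forall l, l \in X -> exists m, [/\ m \in C, own l != m & bport (own l) m l].

Lemma core_grow (C : {set N}) X o t n m : inst_ok I -> ~ good I -> core C X o t -> bported C X ->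
  n \in C -> m \notin C -> blk n m ->
  exists X' o' t', core (m |: C) X' o' t' /\ bported (m |: C) X'.
Proof.
move=> ok ng co bpX nC mC nb; have nm : n != m by case: nb.
(* A symmetric block copies the type of [n]. Otherwise the way from [n] to [m] is the short one if
   [t n] holds and the long one if not, and [m] gets the opposite type: 8 against 7 is then balanced
   by the difference of types in both directions. *)
have [XB [aB [c1 [c2 [tm [ob k1 k2]]]]]] : exists XB aB c1 c2, exists tm : bool, [/\ oblk n m XB aB c1 c2,
    2 * c1 + t n <= 7 + tm & 2 * c2 + tm <= 7 + t n].
  case: (blk_orient ok nb) => [[XB [aB ob]]|[[XB [aB ob]] [XB' [aB' ob']]]].
    by exists XB, aB, 3, 3, (t n); split=> //; case: (t n).
  case tn : (t n); first by exists XB, aB, 3, 4, false.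
  by exists XB', aB', 4, 3, true.
pose DB := [set x in [:: n; m]].
pose t' x := if x == m then tm else t x.
pose X' := X :|: XB.
pose o' := [rel u v | o u v || aB u v].
have inE' u : inS (m |: C) X' u = inS C X u || inS DB XB u.
  case: u => [x|l]; rewrite /= !inE //.
  by case: (eqVneq x m) => [->|_]; rewrite ?orbT ?orbF //=; case: (eqVneq x n) => [->|_];
    rewrite ?nC ?orbF ?orbT.
(* The old part and the new block meet in [n] only. *)
have both u : inS C X u -> inS DB XB u -> u = inl n.
  case: u => [x|l] /=; rewrite ?inE => h1 h2.
    case/orP: h2 => /eqP h2; first by rewrite h2.
    by rewrite h2 (negbTE mC) in h1.
  have lC := co_own co h1; case: (ob_bp ob h2) => [[ln bl]|[lm _]]; last first.
    by rewrite lm (negbTE mC) in lC.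
  have [m' [m'C nm' bm']] := bpX _ h1; rewrite ln in nm' bm'.
  by rewrite (bport_inj ok ng nm nm' bl bm') m'C in mC.
have so : subrel o o' by move=> u v h; rewrite /o' /= h.
have sB : subrel aB o' by move=> u v h; rewrite /o' /= h orbT.
have noloop (a : rel V) u : (forall x y, a x y -> ~~ a y x) -> a u u -> False.
  by move=> an h; move: (an _ _ h); rewrite h.
have kC : 0 < #|C| by apply/card_gt0P; exists n.
have cC : #|m |: C| = #|C|.+1 by rewrite cardsU1 mC.
have tn' : t' n = t n by rewrite /t' (negbTE nm).
have told u : inS C X u -> Pt t' u = Pt t u /\ Qt t' u = Qt t u.
  case: u => [x|l] //= xC; rewrite /t'; case: eqP => // e.
  by rewrite e (negbTE mC) in xC.
have nO : inS C X (inl n) by [].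
have fromn v : inS DB XB v -> exists2 s, reach aB s (inl n) v & 2 * s + t n <= 7 + Pt t' v.
  case: v => [x|l] h; last first.
    exists 5; last by rewrite /=; case: (t n).
    by apply: (ob_all ob) => //; rewrite /= !inE eqxx.
  move: h; rewrite /= !inE => /orP[] /eqP ->.
    by exists 0; [exact: reach0|rewrite tn'; lia].
  by exists c1; [exact: ob_12 ob|rewrite /t' eqxx].
have ton u : inS DB XB u -> exists2 s, reach aB s u (inl n) & 2 * s + ~~ t n <= 7 + Qt t' u.
  case: u => [x|l] h; last first.
    exists 5; last by rewrite /=; case: (t n).
    by apply: (ob_all ob) => //; rewrite /= !inE eqxx.
  move: h; rewrite /= !inE => /orP[] /eqP ->.
    by exists 0; [exact: reach0|rewrite tn'; lia].
  exists c2; [exact: ob_21 ob|rewrite /t' eqxx].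
  by case: (t n) tm k2 {k1 t' tn' told fromn} => [] [] /=; lia.
exists X', o', t'; split; last first.
  move=> l; rewrite inE => /orP[/bpX[m' [h1 h2 h3]]|/(ob_bp ob)[[ln h]|[lm h]]].
  - by exists m'; rewrite inE h1 orbT.
  - by exists m; rewrite !inE eqxx ln.
  - by exists n; rewrite !inE nC orbT lm eq_sym nm.
split.
- move=> l; rewrite inE => /orP[/(co_own co) h|/(ob_bp ob)[[-> _]|[-> _]]].
  + by rewrite inE h orbT.
  + by rewrite inE nC orbT.
  + by rewrite !inE eqxx.
- move=> u v; rewrite !inE' => /orP[/(co_sub co)[-> -> ->]|/(ob_sub ob)[-> hu hv]] //.
  by rewrite hu hv !orbT.
- move=> u v uv; apply/negP => vu; case/orP: uv => uv; case/orP: vu => vu.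
  + by move: (co_anti co uv); rewrite vu.
  + have [_ h1 h2] := co_sub co uv; have [_ h3 h4] := ob_sub ob vu.
    by move: uv; rewrite (both _ h1 h4) (both _ h2 h3) => uv; apply: (noloop o (inl n)) uv; exact: co_anti co.
  + have [_ h1 h2] := co_sub co vu; have [_ h3 h4] := ob_sub ob uv.
    by move: vu; rewrite (both _ h1 h4) (both _ h2 h3) => uv'; apply: (noloop o (inl n)) uv';
      exact: co_anti co.
  + by move: (ob_anti ob uv); rewrite vu.
- move=> l; rewrite inE => /orP[/(co_spoke co)|/(ob_spoke ob)] /orP[] h; rewrite /spoked /o' /= h ?orbT //.
- move=> u v; rewrite !inE' cC => /orP[uO|uB] /orP[vO|vB].
  + have [s r h] := co_dist co uO vO; exists s; first exact: reach_sub r.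
    by have [-> _] := told _ vO; have [_ ->] := told _ uO; move: h kC; clear; lia.
  + have [s r h] := co_dist co uO nO; have [s2 r2 h2] := fromn _ vB.
    exists (s + s2); first by apply: reach_trans (reach_sub so r) (reach_sub sB r2).
    by have [_ ->] := told _ uO; rewrite /= in h; move: h h2 kC; clear; lia.
  + have [s r h] := co_dist co nO vO; have [s2 r2 h2] := ton _ uB.
    exists (s2 + s); first by apply: reach_trans (reach_sub sB r2) (reach_sub so r).
    by have [-> _] := told _ vO; rewrite /= in h; move: h h2 kC; clear; lia.
  + have [->|uv] := eqVneq u v; first by exists 0; [exact: reach0|lia].
    have [en|un] := eqVneq u (inl n).
      have [s2 r2 h2] := fromn _ vB; exists s2; first by rewrite en; exact: reach_sub r2.
      by rewrite en /= tn'; move: (Pt t' v) (t n) h2 kC; clear => P [] /=; lia.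
    have [en|vn] := eqVneq v (inl n).
      have [s2 r2 h2] := ton _ uB; exists s2; first by rewrite en; exact: reach_sub r2.
      by rewrite en /= tn'; move: (Qt t' u) (t n) h2 kC; clear => P [] /=; lia.
    (* One of the two vertices is a port, with allowance 4, and [2 * 5 + 1 = 7 + 4]. *)
    exists 5; first by apply: reach_sub sB _; apply: (ob_all ob).
    case: u v uB vB uv un vn => [x|l] [x'|l'] /=; rewrite ?inE; try by (move: kC; clear; lia).
    move=> /orP[] /eqP -> /orP[] /eqP ->; rewrite ?eqxx //.
Qed.

Lemma core_tree : inst_ok I -> ~ good I -> 0 < #|N| -> exists X o t, core setT X o t.
Proof.
move=> ok ng /card_gt0P[n0 _].
have base : core [set n0] set0 (fun _ _ => false) (fun _ => true).
  split=> //; try by move=> l; rewrite in_set0.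
  move=> [u|l] [v|l'] /=; rewrite ?inE // => /eqP -> /eqP ->.
  by exists 0; [exact: reach0|rewrite cards1].
have grow k : k < #|N| -> exists C X o t, [/\ core C X o t, bported C X & #|C| = k.+1].
  elim: k => [|k IH] kN.
    by exists [set n0], set0, (fun _ _ => false), (fun _ => true); split=> //; [move=> l;
      rewrite inE|rewrite cards1].
  have [C [X [o [t [co bp cC]]]]] := IH (ltnW kN).
  have [n nC] : exists n, n \in C by apply/card_gt0P; rewrite cC.
  have [m mC] : exists m, m \notin C.
    have : 0 < #|~: C| by rewrite cardsCs setCK; lia.
    by case/card_gt0P=> m; rewrite inE; exists m.
  have [n' [m' [h1 h2 h3]]] : exists n' m', [/\ n' \in C, m' \notin C & blk n' m'].
    case/connectP: (blk_connected ok ng n m) => p.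
    elim: p n nC => [|z p IHp] n nC /=; first by move=> _ e; rewrite e nC in mC.
    case/andP=> /blkbP nz pz e; case: (boolP (z \in C)) => zC; last by exists n, z.
    exact: (IHp z).
  have [X' [o' [t' [co' bp']]]] := core_grow ok ng co bp h1 h2 h3.
  by exists (m' |: C), X', o', t'; split=> //; rewrite cardsU1 h2 cC.
have N0 : 0 < #|N| by apply/card_gt0P; exists n0.
have [C [X [o [t [co _ cC]]]]] := grow #|N|.-1 ltac:(lia).
have CT : C = setT.
  by apply/eqP; rewrite eqEcard subsetT cardsT cC; lia.
by rewrite CT in co; exists X, o, t.
Qed.

End Tree.

(** * Contraction of a good piece *)

Section Contract.
Variable I : inst.
Local Notation E := (iE I).
Local Notation N := (iN I).
Local Notation L := (iL I).
Local Notation V := (N + L)%type.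
Variables (DS : {set N}) (XS : {set L}).
Hypothesis own_XS : forall l, l \in XS -> own l \in DS.
Hypothesis ok : inst_ok I.
Variable n0 : N.
Hypothesis n0D : n0 \in DS.

Local Notation N' := (option {n : N | n \notin DS}).
Local Notation L' := (L + E * bool)%type.
Definition cl (n : N) : N' := insub n.
Definition pi' (e : E) (b : bool) : L' := if pi e b \in XS then inr (e, b) else inl (pi e b).
Definition own' (l : L') : N' := if l is inl l then cl (own l) else None.

(* [DS] becomes the node [None]; an edge at a port of [XS] gets a private port there. *)
Definition contract : inst := @Inst E N' L' pi' own'.
Local Notation I' := contract.
Local Notation V' := (N' + L')%type.

Lemma cl_None n : (cl n == None) = (n \in DS).
Proof. by rewrite /cl; case: insubP => [u nD _|]; [rewrite (negbTE nD)|rewrite negbK => ->]. Qed.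

Lemma cl_Some n (x : {n : N | n \notin DS}) : (cl n == Some x) = (n == val x).
Proof.
rewrite /cl; case: insubP => [u nD <-|]; first by [].
rewrite negbK => nD; case: (n =P \val x) => // e.
by move: (valP x); rewrite -e nD.
Qed.

Lemma cl_val (x : {n : N | n \notin DS}) : cl (val x) = Some x.
Proof. exact: valK. Qed.

Lemma cl_onto (x : N') : exists n, cl n = x.
Proof.
case: x => [x|]; first by exists (val x); apply: cl_val.
by exists n0; apply/eqP; rewrite cl_None.
Qed.

Lemma own_pi' e b : own' (pi' e b) = cl (own (pi e b)).
Proof.
rewrite /pi'; case: ifP => //= /own_XS h; by apply/esym/eqP; rewrite cl_None.
Qed.

Lemma pi'_inr e b d : (pi' e b == inr d) = (pi e b \in XS) && ((e, b) == d).
Proof. by rewrite /pi'; case: ifP. Qed.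

Lemma pi'_inl e b l : (pi' e b == inl l) = (pi e b \notin XS) && (pi e b == l).
Proof. by rewrite /pi'; case: ifP. Qed.

Lemma crossing' (A : {set N'}) d :
  @crossing I' A d = @crossing I [set n | cl n \in A] d.
Proof. by rewrite /crossing /= !own_pi' !inE. Qed.

(** Cuts pull back along [cl]. A fresh port carries a single edge, so the spoke condition there is
    the edge condition of [I]. *)
Lemma contract_ok : inst_ok I'.
Proof.
have pre0 (A : {set N'}) : A != set0 -> [set n | cl n \in A] != set0.
  case/set0Pn=> x xA; have [n nx] := cl_onto x.
  by apply/set0Pn; exists n; rewrite inE nx.
have preT (A : {set N'}) : A != setT -> [set n | cl n \in A] != setT.
  move=> AT; apply: contraNneq AT => /setP AT; apply/eqP/setP => x; have [n <-] := cl_onto x.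
  by move: (AT n); rewrite !inE.
have conn (A : {set N'}) : A != set0 -> A != setT -> exists d, @crossing I' A d.
  by move=> A0 AT; have [d dc] := ok_conn ok (pre0 _ A0) (preT _ AT); exists d; rewrite crossing'.
split=> //.
- move=> e b e' b' /=; rewrite /pi'.
  case: ifP => h1; case: ifP => h2 //; first by case.
  case: ifP => h3; case: ifP => h4 //; first by move=> _ [].
  by move=> [q1] [q2]; apply: (ok_simple ok q1 q2).
- move=> e b /=; rewrite /pi'; case: ifP => h1; case: ifP => h2 //.
    by case; case: b {h1 h2}.
  by case; apply: (ok_irr ok).
- by move=> A d h; apply: (ok_edge ok (A := [set n | cl n \in A]) (d := d)) => d'; rewrite -crossing' h.
move=> A l A0 lA h.
have nonempty : (exists d : E * bool, pi' d.1 d.2 == l).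
  have AT : A != setT by apply: contraNneq lA => ->; rewrite inE.
  by have [d] := conn A A0 AT; rewrite h; exists d.
case: l lA h nonempty => [l|d0] /= lA h [d dl].
  apply: (ok_spoke ok (A := [set n | cl n \in A]) (l := l)); first exact: pre0.
    by rewrite inE.
  move=> d'; rewrite -crossing' h /=.
  move: dl; rewrite pi'_inl => /andP[h1 /eqP h2].
  by rewrite pi'_inl; case: eqP => [->|]; rewrite ?andbF // -h2 h1.
apply: (ok_edge ok (A := [set n | cl n \in A]) (d := d)) => d'.
rewrite -crossing' h /=; move: dl; rewrite !pi'_inr -!surjective_pairing => /andP[h1 /eqP h2].
by rewrite h2; case: eqP => [->|]; rewrite ?andbF // -h2 h1.
Qed.

Lemma contract_card : #|iN I'| = #|N| - #|DS| + 1.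
Proof.
rewrite card_option card_sig addn1; congr _.+1.
by rewrite -(cardsC DS) addKn; apply: eq_card => n; rewrite !inE.
Qed.

Definition down (x : V') : V := match x with
  | inl (Some n) => inl (val n) | inl None => inl n0
  | inr (inl l) => inr l | inr (inr d) => inr (pi d.1 d.2) end.
Definition fresh (x : V') := if x is inr (inr _) then true else false.
(** The label type [L'] also contains labels that are no ends: [inl l] with [l] in [XS], and [inr d]
    for a dart starting outside [XS]. Paths must be known to avoid them before they are mapped
    back. *)
Definition real (x : V') := match x with
  | inl (Some n) => true | inl None => false
  | inr (inl l) => l \notin XS | inr (inr d) => pi d.1 d.2 \in XS end.

(** Edges between two ports of [XS] are left to the piece, so that lift and piece never orient the
    same edge. *)
Definition lift (o' : rel V') (u v : V) : bool := match u, v with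
  | inl n, inr l => [&& l \notin XS, own l == n & o' (inl (cl n)) (inr (inl l))]
  | inr l, inl n => [&& l \notin XS, own l == n & o' (inr (inl l)) (inl (cl n))]
  | inr l, inr l' => [exists d : E * bool, [&& pi d.1 d.2 == l, pi d.1 (~~ d.2) == l',
      ~~ ((l \in XS) && (l' \in XS)) & o' (inr (pi' d.1 d.2)) (inr (pi' d.1 (~~ d.2)))]]
  | _, _ => false end.

Lemma lift_flip o' u v : lift (fun x y => o' y x) u v = lift o' v u.
Proof.
case: u v => [n|l] [m|l'] //=; apply/existsP/existsP => -[[e b] /= /and4P[h1 h2 h3 h4]];
  exists (e, ~~ b); rewrite /= negbK; apply/and4P; split=> //; by rewrite andbC.
Qed.

Lemma adj_real x y : @adjI I' x y -> x != inl None -> y != inl None -> real x && real y.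
Proof.
have ed (a b : L') : @edge I' a b -> real (inr a) && real (inr b).
  case/existsP=> -[e c] /= /andP[/eqP <- /eqP <-]; rewrite /pi'.
  by case: ifP => h1; case: ifP => h2 /=; rewrite ?h1 ?h2.
have sp (l : L') n : own' l == Some n -> real (inr l).
  case: l => [l|d] //=; rewrite cl_Some => /eqP h.
  by apply/negP => /own_XS; rewrite h (negbTE (valP n)).
case: x y => [[n|]|a] [[m|]|b] //=; first by move=> /sp.
- by move=> /sp h _ _; rewrite andbT.
- by move=> /ed.
Qed.

Lemma adj_fresh (d : E * bool) y : @adjI I' (inr (inr d)) y -> y != inl None ->
  y = inr (pi' d.1 (~~ d.2)).
Proof.
case: y => [[m|]|b] //= /existsP[d2 /andP[]] /=.
by rewrite pi'_inr -surjective_pairing => /andP[_ /eqP <-] /eqP <-.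
Qed.

Lemma down_pi' e b : down (inr (pi' e b)) = inr (pi e b).
Proof. by rewrite /pi'; case: ifP. Qed.

Lemma fresh_pi' e b : fresh (inr (pi' e b)) = (pi e b \in XS).
Proof. by rewrite /pi'; case: ifP. Qed.

Lemma lift_arc (o' : rel V') x y : o' x y -> @adjI I' x y -> x != inl None -> y != inl None ->
  ~~ (fresh x && fresh y) -> lift o' (down x) (down y).
Proof.
move=> oxy axy xN yN; have := adj_real axy xN yN.
case: x y oxy axy xN yN => [[n|]|a] [[m|]|b] // oxy axy _ _.
- case: b oxy axy => [l|d] //= oxy; rewrite cl_Some => /eqP e lX _.
  by rewrite lX e eqxx cl_val.
- case: a oxy axy => [l|d] //= oxy; rewrite cl_Some => /eqP e; rewrite andbT => lX _.
  by rewrite lX e eqxx cl_val.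
move: axy oxy => /existsP[[e c] /andP[/eqP ea /eqP eb]].
have {}ea : pi' e c = a := ea; have {}eb : pi' e (~~ c) = b := eb.
rewrite -ea -eb => oxy _; rewrite !fresh_pi' !down_pi' => nf.
by apply/existsP; exists (e, c); rewrite /= !eqxx nf oxy.
Qed.

Section Segments.
Variable o' : rel V'.
Hypothesis o'_adj : forall x y, o' x y -> @adjI I' x y.

(** Besides the contracted node a fresh port has one neighbour only, so a path avoiding that node
    cannot pass through it. Hence no arc used here joins two fresh ports, and each one lifts to one
    arc. *)
Lemma seg x p : path o' x p -> uniq (x :: p) -> inl None \notin x :: p ->
  ~~ fresh (last x p) -> reach (lift o') (size p) (down x) (down (last x p)).
Proof.
elim: p x => [|y p IH] x; first by move=> *; apply: reach0.
move=> /= /andP[xy py] /andP[xyp up]; rewrite inE negb_or eq_sym => /andP[xN ypN] fl.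
have yN : y != inl None by move: ypN; rewrite inE negb_or eq_sym => /andP[].
rewrite -[(size p).+1]add1n; apply: reach_trans (IH y py up ypN fl).
apply: reach1 => //; apply: lift_arc => //; first exact: o'_adj.
suff fy : ~~ fresh y by rewrite negb_and fy orbT.
case: y xy py xyp ypN yN fl {IH up} => [//|[//|d]] xy py xyp ypN yN fl.
case: p py xyp ypN fl => [|z p] //= /andP[yz _] xyp ypN _.
have zN : z != inl None by apply: contraNneq ypN => <-; rewrite !inE eqxx orbT.
have e1 := adj_fresh (o'_adj yz) zN.
have e2 := adj_fresh (adjI_sym (o'_adj xy)) xN.
by move: xyp; rewrite e1 e2 !inE eqxx orbT.
Qed.

(** A first step to an old port starts at a real node of the piece, of weight 0. A first step to a
    fresh port disappears in the lift, and the arc saved pays for the weight 2 of the port of [XS]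
    found there. *)
Lemma exit_piece p v : path o' (inl None) p -> uniq (inl None :: p) -> last (inl None) p = v ->
  v != inl None -> ~~ fresh v -> real v ->
  exists z b, [/\ inS DS XS z, reach (lift o') b z (down v) & 2 * b + wt z <= 2 * size p].
Proof.
case: p => [|x p] /=; first by move=> _ _ <-.
move=> /andP[Nx px] /andP[nin up] lv vN fv rv; rewrite -lv in vN fv rv *.
have sg := seg px up nin fv.
have rx : real x.
  case: p px nin {up lv vN fv sg} rv => [//|y p] /= /andP[xy _]; rewrite !inE !negb_or => /and3P[h1 h2 _] _.
  rewrite eq_sym in h1; rewrite eq_sym in h2.
  by have /andP[] := adj_real (o'_adj xy) h1 h2.
have := o'_adj Nx; case: x Nx px nin up lv vN fv rv sg rx => [//|[l|d]] Nx px nin up lv vN fv rv sg rx /=.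
  rewrite cl_None => oD; exists (inl (own l)), (size p).+1; split=> //.
    rewrite -add1n; apply: reach_trans sg; apply: reach1 => //=.
    have -> : cl (own l) = None by apply/eqP; rewrite cl_None.
    by rewrite (rx : l \notin XS) eqxx Nx.
  by rewrite /wt; lia.
move=> _; exists (inr (pi d.1 d.2)), (size p); split=> //.
by rewrite /wt; lia.
Qed.

End Segments.

Lemma enter_piece (o' : rel V') p u : (forall x y, o' x y -> @adjI I' x y) ->
  path o' u p -> uniq (u :: p) -> last u p = inl None ->
  u != inl None -> ~~ fresh u -> real u ->
  exists z b, [/\ inS DS XS z, reach (lift o') b (down u) z & 2 * b + wt z <= 2 * size p].
Proof.
move=> o'a pp up lN uN fu ru.
have [||||z [b [h1 h2 h3]]] := @exit_piece (fun x y => o' y x) _ (rev (belast u p)) u _ _ _ uN fu ru.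
- by move=> x y /o'a /adjI_sym.
- by rewrite -lN rev_path.
- by rewrite -lN -rev_rcons -lastI rev_uniq.
- by case: p {pp up} lN => [/= e|y p _]; [rewrite e eqxx in uN|rewrite /= rev_cons last_rcons].
exists z, b; split=> //; last by rewrite size_rev size_belast in h3.
apply: reach_rev; apply: reach_sub h2 => x y; by rewrite lift_flip.
Qed.

End Contract.

Ltac clia := repeat match goal with H : ?P |- _ =>
  lazymatch P with is_true (leq _ _) => fail | @eq nat _ _ => fail | _ => clear H end end; lia.

Lemma core_lift (I : inst) (DS : {set iN I}) XS aS X' o' t' : inst_ok I -> good_piece DS XS aS ->
  @core (contract DS XS) setT X' o' t' -> exists X o t, @core I setT X o t.
Proof.
move=> ok gp co.
have own_XS := gp_own gp.
have [n0 n0D] : exists n0, n0 \in DS by apply/card_gt0P; have := gp_two gp; clia.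
pose X := XS :|: [set l : iL I | (inl l : iL (contract DS XS)) \in X'].
have inX l : (l \in X) = (l \in XS) || (inl l \in X').
  by rewrite !inE.
pose l2 := @lift I DS XS o'.
pose o := [rel u v | aS u v || l2 u v].
pose t n := t' (cl DS n).
have o'a x y : o' x y -> @adjI (contract DS XS) x y by case/(co_sub co).
have l2S u v : l2 u v -> [/\ adjI u v, inS setT X u, inS setT X v & ~~ (inS DS XS u && inS DS XS v)].
  case: u v => [n|l] [m|l'] //=; rewrite ?inX ?in_setT.
  - move=> /and3P[lX -> oo]; have [_ _ /= h] := co_sub co oo.
    by rewrite h orbT (negbTE lX) andbF.
  - move=> /and3P[lX -> oo]; have [_ /= h _] := co_sub co oo.
    by rewrite h orbT (negbTE lX).
  case/existsP=> -[e b] /= /and4P[/eqP h1 /eqP h2 -> oo]; have [_ h3 h4] := co_sub co oo.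
  split=> //.
  - by apply/existsP; exists (e, b); rewrite h1 h2 !eqxx.
  - by move: h3; rewrite /= /pi' h1; case: (l \in XS) => //= ->.
  - by move: h4; rewrite /= /pi' h2; case: (l' \in XS) => //= ->.
have l2anti u v : l2 u v -> ~~ l2 v u.
  case: u v => [n|l] [m|l'] //=.
  - by move=> /and3P[_ _ oo]; apply/negP => /and3P[_ _]; apply/negP; apply: co_anti co _ _ oo.
  - by move=> /and3P[_ _ oo]; apply/negP => /and3P[_ _]; apply/negP; apply: co_anti co _ _ oo.
  case/existsP=> -[e b] /= /and4P[/eqP h1 /eqP h2 _ oo];
    apply/existsP => -[[e' b'] /= /and4P[/eqP k1 /eqP k2 _ oo']].
  have ee : e = e'.
    by apply: (ok_simple ok (b := b) (b' := ~~ b')); rewrite ?negbK ?h1 ?k2 ?h2 ?k1.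
  have bb : b' = ~~ b.
    case: (eqVneq b' (~~ b)) => // ne; case: (ok_irr ok (e := e) (b := b)).
    by rewrite h2 -k1 -ee; congr (pi _ _); case: b b' ne {h1 h2 k1 k2 oo oo'} => [] [].
  by move: (co_anti co oo); rewrite ee; rewrite bb negbK in oo'; rewrite oo'.
have iSX u : inS DS XS u -> inS setT X u.
  by case: u => [n|l] /=; rewrite ?inX ?in_setT // => ->.
have so : subrel aS o by move=> u v h; rewrite /o /= h.
have sl : subrel l2 o by move=> u v h; rewrite /o /= h orbT.
exists X, o, t; split.
- by move=> l _; rewrite in_setT.
- move=> u v /orP[/(gp_sub gp)[? /iSX ? /iSX ?]|/l2S[]] //.
- move=> u v /orP[] uv; apply/negP => /orP[] vu.
  + by move: (gp_anti gp uv); rewrite vu.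
  + have [_ h1 h2] := gp_sub gp uv; have [_ _ _] := l2S _ _ vu.
    by rewrite h1 h2.
  + have [_ h1 h2] := gp_sub gp vu; have [_ _ _] := l2S _ _ uv.
    by rewrite h1 h2.
  + by move: (l2anti _ _ uv); rewrite vu.
- move=> l; rewrite inX; case: (boolP (l \in XS)) => [lX _|lX /= lX'].
    by have /orP[h|h] := gp_spoke gp lX; rewrite /spoked /o /= h ?orbT.
  have /orP[h|h] := co_spoke co lX'; rewrite /spoked /o /l2 /= lX eqxx /=.
    by rewrite h orbT.
  by rewrite h !orbT.
pose up (u : iN I + iL I) : iN (contract DS XS) + iL (contract DS XS) :=
  if inS DS XS u then inl None else match u with inl n => inl (cl DS n) | inr l => inr (inl l) end.
have upX u : inS setT X u -> inS setT X' (up u).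
  rewrite /up; case: ifP; first by rewrite /= in_setT.
  by case: u => [n|l] /=; rewrite ?in_setT // inX => ->.
have upn u : ~~ inS DS XS u -> [/\ up u != inl None, ~~ @fresh I DS (up u),
  @real I DS XS (up u) & @down I DS n0 (up u) = u].
  rewrite /up => h; rewrite (negbTE h); case: u h => [n|l] //= nD.
  have /eqP e := cl_Some n (Sub n nD : {n | n \notin DS}).
  rewrite SubK eqxx in e; move: e => /eqP/eqP ->.
  by split.
(* A port of the piece has allowance 4, enough for its weight 2 and the type of the contracted
   node. *)
have PQ u : (if inS DS XS u then wt u else 0) + Pt t' (up u) <= Pt t u
         /\ (if inS DS XS u then wt u else 0) + Qt t' (up u) <= Qt t u.
  rewrite /up; case: ifP => h; last by case: u h.
  case: u h => [n|l] /=; last by case: (t' None).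
  by move=> nD; rewrite /t (_ : cl DS n = None) //; apply/eqP; rewrite cl_None.
have g2 := gp_two gp.
have gN : #|DS| <= #|iN I| by apply: max_card.
move=> u v uX vX; rewrite cardsT.
case: (boolP (inS DS XS u && inS DS XS v)) => [/andP[uS vS]|nS].
  have [s r h] := gp_dist gp uS vS; exists s; first exact: reach_sub r.
  (* All nodes of the piece inherit one type, so for two of them [Pt] and [Qt] add up to exactly
     1. *)
  suff : wt u + wt v + 1 <= Pt t v + Qt t u by clia.
  have /= [hp hq] := (PQ v, PQ u); rewrite /up uS vS in hp hq *.
  by case: hp hq => /= h1 h2 [h3 h4]; case: (t' None) h1 h2 h3 h4 => /=; clia.
have [s [p [p1 p2 p3]] h] := co_dist co (upX u uX) (upX v vX).
rewrite cardsT contract_card // in h.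
have [p' [pp up' lp sp]] : exists p', [/\ path o' (up u) p', uniq (up u :: p'),
  last (up u) p' = up v & size p' <= s].
  move: p2 p3; case/shortenP: p1 => p' q1 q2 q3 <- q4; exists p'; split=> //.
  by apply: leq_trans q4; apply: uniq_leq_size => //; case/andP: q2.
have [hpv _] := PQ v; have [_ hqu] := PQ u.
have [uin|uout] := boolP (inl None \in up u :: p'); last first.
  have uS : ~~ inS DS XS u by apply: contra uout => uS; rewrite /up uS mem_head.
  have vS : ~~ inS DS XS v.
    by apply: contra uout => vS; rewrite (_ : inl None = last (up u) p') ?mem_last // lp /up vS.
  have [u1 u2 u3 u4] := upn _ uS; have [v1 v2 v3 v4] := upn _ vS.
  exists (size p').
    rewrite -u4 -v4 -lp; apply: reach_sub sl _; apply: seg => //.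
    by rewrite lp.
  by rewrite (negbTE uS) in hqu; rewrite (negbTE vS) in hpv; clia.
(* The path is cut at the contracted node and the piece supplies the middle: [7 * (#|iN I| - #|DS|)]
   outside and [7 * (#|DS| - 1)] inside. *)
have [p1' [p2' [[q1 q1'] q2 [q3 q3'] q4 q5]]] : exists q1 q2, [/\ path o' (up u) q1 /\ uniq (up u :: q1),
  last (up u) q1 = inl None,
    path o' (inl None) q2 /\ uniq (inl None :: q2), last (inl None) q2 = up v & size q1 + size q2 <= s].
  move: uin pp up' lp sp; rewrite inE => /predU1P[<-|/splitPr[s1 s2]] pp up' lp sp.
    by exists [::], p'; split.
  exists (rcons s1 (inl None)), s2; split.
  - move: pp; rewrite -cat_rcons cat_path => /andP[-> _]; split=> //.
    by move: up'; rewrite -cat_rcons -cat_cons cat_uniq => /andP[].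
  - by rewrite last_rcons.
  - move: pp; rewrite cat_path /= => /and3P[_ _ ->]; split=> //.
    by move: up'; rewrite -cat_cons cat_uniq => /and3P[].
  - by move: lp; rewrite last_cat.
  - by move: sp; rewrite size_cat size_rcons /=; clia.
have [y [a [yS ry ha]]] : exists y a, [/\ inS DS XS y, reach o a u y
    & 2 * a + wt y <= 2 * size p1' + (if inS DS XS u then wt u else 0)].
  case: ifP => uS; first by exists u, 0; split=> //; [exact: reach0|clia].
  have [u1 u2 u3 u4] := upn _ (negbT uS).
  have [y [a [h1 h2 h3]]] := enter_piece own_XS n0D o'a q1 q1' q2 u1 u2 u3.
  by exists y, a; split=> //; [rewrite -u4; apply: reach_sub h2|rewrite addn0; exact: h3].
have [z [b [zS rz hb]]] : exists z b, [/\ inS DS XS z, reach o b z v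
    & 2 * b + wt z <= 2 * size p2' + (if inS DS XS v then wt v else 0)].
  case: ifP => vS; first by exists v, 0; split=> //; [exact: reach0|clia].
  have [u1 u2 u3 u4] := upn _ (negbT vS).
  have [y' [a' [h1 h2 h3]]] := exit_piece own_XS n0D o'a q3 q3' q4 u1 u2 u3.
  by exists y', a'; split=> //; [rewrite -u4; apply: reach_sub h2|rewrite addn0; exact: h3].
have [c rc hc] := gp_dist gp yS zS.
exists (a + (c + b)).
  by apply: reach_trans ry _; apply: reach_trans (reach_sub so rc) rz.
by clia.
Qed.

Theorem core_exists k (I : inst) : #|iN I| <= k -> inst_ok I -> 0 < #|iN I| ->
  exists X o t, @core I setT X o t.
Proof.
elim: k I => [|k IH] I kI ok N0; first by lia.
case: (pselect (good I)) => [[DS [XS [aS gp]]]|ng]; last exact: core_tree.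
have [n0 n0D] : exists n0, n0 \in DS by apply/card_gt0P; have := gp_two gp; lia.
have := contract_card DS XS; have := gp_two gp; have : #|DS| <= #|iN I| by apply: max_card.
move=> h1 h2 h3.
have [X' [o' [t' co]]] : exists X o t, @core (contract DS XS) setT X o t.
  apply: IH; first by rewrite h3; lia.
    exact: (contract_ok (gp_own gp) ok n0D).
  by rewrite h3; lia.
exact: core_lift ok gp co.
Qed.

(** * From graphs to instances *)

Lemma cross_exists (T : finType) (r : rel T) (B : {set T}) x y :
  (forall x y, connect r x y) -> x \notin B -> y \in B ->
  exists u v, [/\ r u v, u \notin B & v \in B].
Proof.
move=> con xB yB; case/connectP: (con x y) => p.
elim: p x xB => [|z p IH] x xB /=; first by move=> _ e; rewrite e (negbTE xB) in yB.
case/andP=> xz pz e; case: (boolP (z \in B)) => zB; first by exists x, z.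
exact: (IH z).
Qed.

Section GraphInstance.
Variables (G : sgraph) (D : {set G}).
Hypothesis conG : connected_graph G.
Hypothesis brl : bridgeless G.
Hypothesis domD : dominating D.

(** The default [x] is never reached when [D] is dominating. *)
Definition dm (x : G) : G := if x \in D then x else odflt x [pick y in D | adj x y].

Lemma dm_in x : dm x \in D.
Proof.
rewrite /dm; case: ifP => // /negbT xD.
case: pickP => [y /andP[] //|no].
have := forallP domD x; rewrite xD => /existsP[y yP].
by have := no y; rewrite /= yP.
Qed.

Lemma dm_adj x : x \notin D -> adj x (dm x).
Proof.
move=> xD; rewrite /dm (negbTE xD); case: pickP => [y /andP[] //|no].
have := forallP domD x; rewrite xD => /existsP[y yP].
by have := no y; rewrite /= yP.
Qed.

Lemma dm_id x : x \in D -> dm x = x.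
Proof. by rewrite /dm => ->. Qed.

Definition spokeG (x y : G) := ((x \notin D) && (y == dm x)) || ((y \notin D) && (x == dm y)).

Definition is_link (p : G * G) :=
  [&& adj p.1 p.2, enum_rank p.1 < enum_rank p.2 & ~~ spokeG p.1 p.2].

Definition gN := {x : G | x \in D}.
Definition gE := {p : G * G | is_link p}.
Definition gL := (G + gE * bool)%type.

Definition nf (x : G) : gN := Sub (dm x) (dm_in x).
Definition gend (e : gE) (b : bool) : G := if b then (val e).2 else (val e).1.
(* A link ending at a dominating vertex gets its own port there. *)
Definition gpi (e : gE) (b : bool) : gL :=
  if gend e b \in D then inr (e, b) else inl (gend e b).
Definition gown (l : gL) : gN := match l with inl v => nf v | inr d => nf (gend d.1 d.2) end.
Definition gI : inst := @Inst gE gN gL gpi gown.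

Lemma gown_pi e b : gown (gpi e b) = nf (gend e b).
Proof. by rewrite /gpi; case: ifP. Qed.

Lemma gpi_inr e b d : (gpi e b == inr d) = (gend e b \in D) && ((e, b) == d).
Proof. by rewrite /gpi; case: ifP. Qed.

Lemma gpi_inl e b v : (gpi e b == inl v) = (gend e b \notin D) && (gend e b == v).
Proof. by rewrite /gpi; case: ifP. Qed.

Lemma spokeG_sym x y : spokeG x y = spokeG y x.
Proof. by rewrite /spokeG orbC. Qed.

Lemma gend_adj e b : adj (gend e b) (gend e (~~ b)).
Proof.
by have /and3P[h _ _] := valP e; rewrite /gend; case: b => //=; rewrite adj_sym.
Qed.

Lemma gend_nspoke e b : ~~ spokeG (gend e b) (gend e (~~ b)).
Proof. by have /and3P[_ _ h] := valP e; rewrite /gend; case: b => //=; rewrite spokeG_sym. Qed.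

Lemma dart_of x y : adj x y -> ~~ spokeG x y -> exists e b, gend e b = x /\ gend e (~~ b) = y.
Proof.
move=> xy ns; case: (ltngtP (enum_rank x) (enum_rank y)) => h.
- have P : is_link (x, y) by apply/and3P.
  by exists (Sub (x, y) P), false.
- have P : is_link (y, x) by apply/and3P; split=> //=; [rewrite adj_sym|rewrite spokeG_sym].
  by exists (Sub (y, x) P), true.
- by move/val_inj/enum_rank_inj: h => h; rewrite h adj_irrefl in xy.
Qed.

Lemma gend_inj e b e' b' : gend e b = gend e' b' -> gend e (~~ b) = gend e' (~~ b') -> e = e' /\ b = b'.
Proof.
have /and3P[_ r1 _] := valP e; have /and3P[_ r2 _] := valP e'.
rewrite /gend; case: b; case: b' => /= h1 h2.
- by split=> //; apply: val_inj; rewrite [LHS]surjective_pairing h1 h2 -surjective_pairing.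
- by move: r1 r2; rewrite /= h1 h2 => r1 /(ltn_trans r1); rewrite ltnn.
- by move: r1 r2; rewrite /= h1 h2 => r1 /(ltn_trans r1); rewrite ltnn.
- by split=> //; apply: val_inj; rewrite [LHS]surjective_pairing h1 h2 -surjective_pairing.
Qed.

Lemma nf_dm x : nf (dm x) = nf x.
Proof. by apply: val_inj; rewrite /= dm_id // dm_in. Qed.

Lemma spoke_nf x y : spokeG x y -> nf x = nf y.
Proof. by case/orP=> /andP[_ /eqP ->]; rewrite nf_dm. Qed.

Lemma connected_remove (x y : G) : adj x y -> forall u v, connect (remove_edge x y) u v.
Proof.
move=> xy; have : connected_rel (remove_edge x y).
  by apply: contrapT => h; apply: (@brl x y).
by case.
Qed.

Lemma nf_onto (n : gN) : nf (val n) = n.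
Proof. by apply: val_inj; rewrite /= dm_id // (valP n). Qed.

Lemma gcrossing (A : {set iN gI}) d :
  @crossing gI A d = (nf (gend d.1 d.2) \notin A) && (nf (gend d.1 (~~ d.2)) \in A).
Proof. by rewrite /crossing /= !gown_pi. Qed.

Lemma gI_ok : inst_ok gI.
Proof.
pose B (A : {set iN gI}) : {set G} := [set x | nf x \in A].
have conn (A : {set iN gI}) : A != set0 -> A != setT -> exists d, @crossing gI A d.
  case/set0Pn=> y yA AT.
  have [x xA] : exists x, x \notin A.
    by apply/existsP; apply: contraNT AT; rewrite negb_exists => /forallP h; apply/eqP/setP => z;
      rewrite in_setT; apply/negPn; apply: h.
  have [||u [v [uv uB vB]]] := @cross_exists _ (@adj G) (B A) (val x) (val y) (proj2 conG).
  - by rewrite inE nf_onto.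
  - by rewrite inE nf_onto.
  have [|e [b [h1 h2]]] := dart_of uv.
    by apply/negP => /spoke_nf e; move: uB vB; rewrite !inE e => /negP.
  by exists (e, b); rewrite gcrossing /= h1 h2; rewrite !inE in uB vB; rewrite uB.
have one (A : {set iN gI}) d : ~ (forall d', @crossing gI A d' = (d' == d)).
  move=> h; have := h d; rewrite eqxx gcrossing => /andP[dB dA].
  have [||u [v [uv uB vB]]] := @cross_exists _ _ (B A) (gend d.1 d.2) (gend d.1 (~~ d.2)) (connected_remove
    (gend_adj d.1 d.2)).
  - by rewrite inE.
  - by rewrite inE.
  case/andP: uv => uv; rewrite !inE negb_or => /andP[ne _].
  have [|e [b [h1 h2]]] := dart_of uv.
    by apply/negP => /spoke_nf e; move: uB vB; rewrite !inE e => /negP.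
  have : @crossing gI A (e, b) by rewrite gcrossing /= h1 h2; rewrite !inE in uB vB; rewrite uB.
  rewrite h => /eqP e1; case/negP: ne; rewrite -h1 -h2 -e1 /=; exact: eqxx.
split=> //.
- move=> e b e' b' /=; rewrite /gpi.
  case: ifP => h1; case: ifP => h2 //; first by case.
  case: ifP => h3; case: ifP => h4 //; first by move=> _ [].
  by move=> [q1] [q2]; case: (gend_inj q1 q2).
- move=> e b /=; rewrite /gpi; case: ifP => h1; case: ifP => h2 //.
    by case; case: b {h1 h2}.
  by case=> h; have := gend_adj e b; rewrite -h adj_irrefl.
move=> A l A0 lA h.
have [d dl] : exists d : gE * bool, gpi d.1 d.2 == l.
  have AT : A != setT by apply: contraNneq lA => ->; rewrite in_setT.
  by have [d] := conn A A0 AT; rewrite h; exists d.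
case: l lA h dl => [v|d0] /= lA h dl; last first.
  apply: (one A d) => d'; rewrite h /=.
  move: dl; rewrite !gpi_inr -!surjective_pairing => /andP[h1 /eqP h2].
  by rewrite h2; case: eqP => [->|]; rewrite ?andbF // -h2 h1.
move: dl; rewrite gpi_inl => /andP[dD /eqP dv]; rewrite dv in dD.
have vdm : dm v != v by apply: contraNneq dD => <-; apply: dm_in.
(* Adding [v] to the preimage of [A] makes its spoke a crossing edge. As the spoke is no bridge,
   another edge crosses; it either joins [v] to a vertex outside the preimage or crosses the cut
   away from [v], and both contradict [h]. *)
have [||u [w [uw uB wB]]] := @cross_exists _ _ (v |: B A) (dm v) v (connected_remove (dm_adj dD)).
- by rewrite !inE negb_or vdm nf_dm.
- by rewrite !inE eqxx.
case/andP: uw => uw; rewrite !inE negb_or => /andP[ne1 ne2].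
move: uB; rewrite !inE negb_or => /andP[uv uA].
have atv e b : gend e b = v -> @crossing gI A (e, b).
  by move=> ev; rewrite h /= gpi_inl ev dD eqxx.
move: wB; rewrite !inE => /predU1P[wv|wA].
  rewrite {w}wv in uw ne1 ne2.
  have [|e [b [h1 h2]]] := dart_of uw.
    rewrite /spokeG dD /= negb_or; apply/andP; split; last first.
      by apply: contra ne2 => /eqP ->.
    by apply/negP => /andP[_ /eqP e]; rewrite e dm_in in dD.
  have := atv e (~~ b) h2; rewrite gcrossing /= negbK h1 (negbTE uA).
  by rewrite andbF.
have [|e [b [h1 h2]]] := dart_of uw.
  by apply/negP => /spoke_nf e; move: uA wA; rewrite e => /negP.
have : @crossing gI A (e, b) by rewrite gcrossing /= h1 h2 uA.
by rewrite h /= gpi_inl h1 (negbTE uv) andbF.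
Qed.

Lemma gN_card : #|iN gI| = #|D|.
Proof. by rewrite card_sig; apply: eq_card. Qed.

End GraphInstance.

(** * Bounding [dist] and [diam] by walks *)

Section DistanceBounds.
Variables (T : finType) (o : rel T).

Lemma bigminn_le (s : seq 'I_#|T|) (P : pred 'I_#|T|) i : i \in s -> P i ->
  \big[minn/#|T|]_(k <- s | P k) (k : nat) <= i.
Proof.
elim: s => // j s IH; rewrite inE big_cons => /predU1P[<- ->|is_ Pi]; first exact: geq_minl.
case: ifP => _; last exact: IH.
by apply: leq_trans (geq_minr _ _) _; apply: IH.
Qed.

Lemma reach_dpath n x y : reach o n x y -> exists2 p, dpath o x y p & size p <= n.
Proof.
case=> p0 [p1 p2 p3]; move: p2 p3; case/shortenP: p1 => p q1 q2 q3 e q4.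
exists p; first by rewrite /dpath q1 q2 e eqxx.
by apply: leq_trans q4; apply: uniq_leq_size => //; case/andP: q2.
Qed.

Lemma dpath_size x y p : dpath o x y p -> size p < #|T|.
Proof. by case/and3P=> _ _ u; have := max_card (mem (x :: p)); rewrite (card_uniqP u). Qed.

Lemma dist_le n x y : reach o n x y -> dist o x y <= n.
Proof.
case/reach_dpath=> p pp sp; apply: leq_trans sp; have lt := dpath_size pp.
rewrite /dist -[X in _ <= X]/(val (Ordinal lt)); apply: bigminn_le; first exact: mem_index_enum.
by apply/existsP; exists (in_tuple p).
Qed.

Lemma dist_ge m x y : (exists p, dpath o x y p) -> (forall p, dpath o x y p -> m <= size p) ->
  m <= dist o x y.
Proof.
move=> [p0 h0] h; rewrite /dist; elim/big_ind: _.
- exact: leq_trans (h _ h0) (ltnW (dpath_size h0)).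
- by move=> a b ha hb; rewrite leq_min ha hb.
- by move=> i /existsP[p /h]; rewrite size_tuple.
Qed.

Lemma diam_le n : (forall x y, reach o n x y) -> diam o <= n.
Proof.
move=> h; apply/bigmax_leqP => x _; apply/bigmax_leqP => y _.
by rewrite /theta geq_max !dist_le.
Qed.

Lemma dist_diam x y : dist o x y <= diam o.
Proof.
rewrite /diam; apply: leq_trans (leq_bigmax x); apply: leq_trans (leq_bigmax y).
exact: leq_maxl.
Qed.

End DistanceBounds.

Lemma oriented_diam_le (G : sgraph) n (o : rel G) : orientation o -> (forall x y, reach o n x y) ->
  exists2 d, is_oriented_diam G d & d <= n.
Proof.
move=> oo re.
have st : strong o by move=> x y; have [p pp _] := reach_dpath (re x y); exists p.
pose P d := `[< exists o : rel G, [/\ orientation o, strong o & diam o = d] >].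
have exP : exists d, P d by exists (diam o); apply/asboolP; exists o.
case: (ex_minnP exP) => d /asboolP dP dmin; exists d.
  by split=> // o' h1 h2; apply: dmin; apply/asboolP; exists o'.
apply: leq_trans (diam_le re); apply: dmin; apply/asboolP; by exists o.
Qed.

(** * Extending the partial orientation to the whole graph *)

Section FinalOrientation.
Variables (G : sgraph) (D : {set G}).
Hypothesis conG : connected_graph G.
Hypothesis brl : bridgeless G.
Hypothesis domD : dominating D.
Local Notation I := (gI domD).
Local Notation V := (iN I + iL I)%type.
Local Notation dm := (dm D).
Local Notation nf := (nf domD).
Variables (X : {set iL I}) (o : rel V) (t : iN I -> bool).
Hypothesis co : @core I setT X o t.

Definition hG (u : V) : G := match u with
  | inl n => val n | inr (inl v) => v | inr (inr d) => dm (gend d.1 d.2) end.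

Definition p0 (x y : G) :=
  [|| [exists d : gE D * bool, [&& gend d.1 d.2 == x, gend d.1 (~~ d.2) == y
        & o (inr (gpi d.1 d.2)) (inr (gpi d.1 (~~ d.2)))]],
      [&& x \notin D, y == dm x & o (inr (inl x)) (inl (nf x))]
    | [&& y \notin D, x == dm y & o (inl (nf y)) (inr (inl y))]].

Definition usedG (x : G) := (x \in D) || (inl x \in X).

Lemma hG_pi e b : hG (inr (gpi e b)) = gend e b.
Proof. by rewrite /gpi; case: ifP => //= h; rewrite dm_id. Qed.

(** Private ports at a dominating vertex collapse to it, so their spokes become walks of length 0;
    distances can only shrink. *)
Lemma p0_hom u v : o u v -> reach p0 1 (hG u) (hG v).
Proof.
move=> ouv; have [auv _ _] := co_sub co ouv; case: u v ouv auv => [n|a] [m|b] //.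
- case: b => [v|d] ouv /eqP /= own_v.
    case: (boolP (v \in D)) => vD; first by rewrite -own_v /= dm_id //; exact: reach0.
    by apply: reach1 => //; rewrite /p0 vD -own_v /= eqxx own_v ouv !orbT.
  by rewrite -own_v; exact: reach0.
- case: a => [v|d] ouv /eqP /= own_v.
    case: (boolP (v \in D)) => vD; first by rewrite -own_v /= dm_id //; exact: reach0.
    by apply: reach1 => //; rewrite /p0 vD -own_v /= eqxx own_v ouv !orbT.
  by rewrite -own_v; exact: reach0.
move=> ouv /existsP[[e c] /andP[/eqP ea /eqP eb]].
have {}ea : gpi e c = a := ea; have {}eb : gpi e (~~ c) = b := eb.
rewrite -ea -eb in ouv *; rewrite !hG_pi; apply: reach1 => //.
by apply/orP; left; apply/existsP; exists (e, c); rewrite /= !eqxx ouv.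
Qed.

Lemma p0_adj x y : p0 x y -> adj x y.
Proof.
case/or3P.
- by case/existsP=> d /and3P[/eqP <- /eqP <- _]; apply: gend_adj.
- by case/and3P=> xD /eqP -> _; apply: dm_adj.
- by case/and3P=> xD /eqP -> _; rewrite adj_sym; apply: dm_adj.
Qed.

Lemma used_pi e b : inS setT X (inr (gpi e b) : V) -> usedG (gend e b).
Proof. by rewrite /= /gpi /usedG; case: (gend e b \in D). Qed.

Lemma p0_used x y : p0 x y -> usedG x && usedG y.
Proof.
case/or3P.
- case/existsP=> d /and3P[/eqP <- /eqP <- oo]; have [_ h1 h2] := co_sub co oo.
  by rewrite !used_pi.
- by case/and3P=> xD /eqP -> oo; have [_ h _] := co_sub co oo; rewrite /usedG (h : inl x \in X) orbT dm_in.
- by case/and3P=> yD /eqP -> oo; have [_ _ h] := co_sub co oo; rewrite /usedG (h : inl y \in X) orbT dm_in.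
Qed.

Lemma p0_anti x y : p0 x y -> ~~ p0 y x.
Proof.
have ds (d : gE D * bool) : ~~ spokeG D (gend d.1 d.2) (gend d.1 (~~ d.2)) by apply: gend_nspoke.
move=> xy; apply/negP => yx; case/or3P: xy; case/or3P: yx.
- move=> /existsP[[e b] /= /and3P[/eqP h1 /eqP h2 oo]] /existsP[[e' b'] /= /and3P[/eqP k1 /eqP k2 oo']].
  have [||ee bb] := @gend_inj _ _ e b e' (~~ b'); rewrite ?negbK ?h1 ?h2 //.
  by rewrite ee bb negbK in oo; move: (co_anti co oo); rewrite oo'.
- move=> /and3P[yD /eqP xE _] /existsP[d /and3P[/eqP h1 /eqP h2 _]].
  by move: (ds d); rewrite h1 h2 /spokeG yD xE eqxx orbT.
- move=> /and3P[xD /eqP yE _] /existsP[d /and3P[/eqP h1 /eqP h2 _]].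
  by move: (ds d); rewrite h1 h2 /spokeG xD yE eqxx.
- move=> /existsP[d /and3P[/eqP h1 /eqP h2 _]] /and3P[xD /eqP yE _].
  by move: (ds d); rewrite h1 h2 /spokeG xD yE eqxx orbT.
- by move=> /and3P[yD /eqP xE _] /and3P[xD /eqP yE _]; rewrite xE dm_in in xD.
- move=> /and3P[xD /eqP yE oo] /and3P[_ _ oo'].
  by move: (co_anti co oo); rewrite oo'.
- move=> /existsP[d /and3P[/eqP h1 /eqP h2 _]] /and3P[yD /eqP xE _].
  by move: (ds d); rewrite h1 h2 /spokeG yD xE eqxx.
- move=> /and3P[yD /eqP xE oo] /and3P[_ _ oo'].
  by move: (co_anti co oo); rewrite oo'.
- by move=> /and3P[xD /eqP yE _] /and3P[yD /eqP xE _]; rewrite xE dm_in in xD.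
Qed.

Definition wG (x : G) := if x \in D then 1 else 4.

Lemma p0_dist x y : usedG x -> usedG y ->
  exists2 s, reach p0 s x y & 2 * s + 1 <= 7 * (#|D| - 1) + wG x + wG y.
Proof.
have up z : usedG z -> exists u : V, [/\ inS setT X u, hG u = z, Pt t u <= wG z & Qt t u <= wG z].
  rewrite /usedG /wG; case: ifP => zD /=.
    move=> _; exists (inl (nf z)); rewrite /= in_setT dm_id //; split=> //; exact: leq_b1.
  by move=> zX; exists (inr (inl z)).
move=> /up[u [uX <- _ hu]] /up[v [vX <- hv _]].
have [s r h] := co_dist co uX vX; exists s; first exact: (reach_hom p0_hom).
by rewrite cardsT gN_card in h; lia.
Qed.

(* Each remaining vertex is coloured by the direction of its spoke; a colouring with the largest number
   of bichromatic edges lets every such vertex be left and entered within two steps. *)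
Definition bich (c : {ffun G -> bool}) : {set G * G} :=
  [set p | [&& adj p.1 p.2, p.1 \notin D, p.2 \notin D & c p.1 != c p.2]].
Definition colour_ok (c : {ffun G -> bool}) :=
  [forall x, (x \notin D) && (inl x \in X) ==> (c x == p0 (dm x) x)].

Lemma used_spoke x : x \notin D -> inl x \in X -> p0 (dm x) x (+) p0 x (dm x).
Proof.
move=> xD xX; have /orP[h|h] := co_spoke co xX.
  have k : p0 x (dm x) by rewrite /p0 xD eqxx (h : o (inr (inl x)) (inl (nf x))) orbT.
  by rewrite k (negbTE (p0_anti k)).
have k : p0 (dm x) x by rewrite /p0 xD eqxx (h : o (inl (nf x)) (inr (inl x))) !orbT.
by rewrite k (negbTE (p0_anti k)).
Qed.

Lemma best_colour : exists c : {ffun G -> bool}, colour_ok c /\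
  forall v, v \notin D -> inl v \notin X -> (exists2 w, adj v w & w \notin D) ->
    exists w, [/\ adj v w, w \notin D & c w = ~~ c v].
Proof.
pose c0 : {ffun G -> bool} := [ffun x => p0 (dm x) x].
have ok0 : colour_ok c0 by apply/forallP => x; rewrite ffunE eqxx implybT.
case: (@arg_maxnP _ c0 colour_ok (fun c => #|bich c|) ok0) => c okc cmax.
exists c; split=> // v vD vX [w vw wD]; apply: contrapT => no.
have same z : adj v z -> z \notin D -> c z = c v.
  move=> vz zD; case: (eqVneq (c z) (c v)) => // ne; case: no; exists z; split=> //.
  by case: (c z) (c v) ne => [] [].
(* The vertex [v] is not covered, so its colour is free. If all its neighbours outside [D] share it,
   flipping loses no bichromatic edge and gains one. *)
pose c' : {ffun G -> bool} := [ffun x => if x == v then ~~ c v else c x].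
have okc' : colour_ok c'.
  apply/forallP => x; apply/implyP => /andP[xD xX]; rewrite ffunE.
  case: (x =P v) => [e|_]; first by rewrite -e xX in vX.
  by have := forallP okc x; rewrite xD xX.
have : bich c \proper bich c'.
  apply/properP; split.
    apply/subsetP => -[x y]; rewrite !inE /= !ffunE => /and4P[xy xD yD ne].
    rewrite xy xD yD /=; case: (eqVneq x v) => [xv|xv]; case: (eqVneq y v) => [yv|yv] //.
    - by rewrite xv yv adj_irrefl in xy.
    - by rewrite xv (same y) ?eqxx // -xv in ne.
    - by rewrite yv (same x) ?eqxx // -yv adj_sym in ne.
  exists (v, w); rewrite !inE /= vw vD wD /=; last by rewrite (same w) // eqxx.
  rewrite !ffunE eqxx; case: (w =P v) => [e|_]; first by rewrite e adj_irrefl in vw.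
  by rewrite (same w) //; case: (c v).
by move/proper_card=> lt; have := cmax _ okc'; rewrite /geq /= leqNgt lt.
Qed.

Lemma other_nbr v : v \notin D -> exists2 w, adj v w & w != dm v.
Proof.
move=> vD; have con := connected_remove brl (dm_adj domD vD).
have [||u [w [uw uB wB]]] := @cross_exists _ _ (~: [set v]) v (dm v) con.
- by rewrite !inE eqxx.
- by rewrite !inE; apply: contraNneq vD => <-; apply: dm_in.
move: uB; rewrite !inE negbK => /eqP e; rewrite {u}e in uw.
case/andP: uw => vw; rewrite !inE negb_or => /andP[ne _]; exists w => //.
by apply: contra ne => /eqP ->.
Qed.

Section WithColour.
Variable c : {ffun G -> bool}.
Hypothesis okc : colour_ok c.
Hypothesis bestc : forall v, v \notin D -> inl v \notin X -> (exists2 w, adj v w & w \notin D) ->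
    exists w, [/\ adj v w, w \notin D & c w = ~~ c v].

(** Colour [true] means that the spoke enters the vertex and its other edges to [D] leave it; for
    [false] the directions are reversed. Between two vertices outside [D] the arc goes from [true]
    to [false]. *)
Definition q0 (x y : G) := [&& adj x y, ~~ (usedG x && usedG y) &
  if x \in D then (if x == dm y then c y else ~~ c y)
  else if y \in D then (if y == dm x then ~~ c x else c x)
  else c x && ~~ c y].

Lemma q0_anti x y : q0 x y -> ~~ q0 y x.
Proof.
case/and3P=> xy nu h; apply/negP => /and3P[_ _ k]; move: h k.
case: (boolP (x \in D)) => xD; case: (boolP (y \in D)) => yD.
- by move: nu; rewrite /usedG xD yD.
- by case: (x == dm y); case: (c y).
- by case: (y == dm x); case: (c x).
- by case: (c x); case: (c y).
Qed.

Definition pf (x y : G) := p0 x y || q0 x y.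
Definition fo (x y : G) := pf x y || [&& adj x y, ~~ pf y x & enum_rank x < enum_rank y].

Lemma pf_anti x y : pf x y -> ~~ pf y x.
Proof.
move=> xy; apply/negP => yx; case/orP: xy => xy; case/orP: yx => yx.
- by move: (p0_anti xy); rewrite yx.
- by have /andP[h1 h2] := p0_used xy; case/and3P: yx => _; rewrite h1 h2.
- by have /andP[h1 h2] := p0_used yx; case/and3P: xy => _; rewrite h1 h2.
- by move: (q0_anti xy); rewrite yx.
Qed.

Lemma pf_adj x y : pf x y -> adj x y.
Proof. by case/orP=> [/p0_adj|/and3P[]]. Qed.

Lemma fo_orientation : orientation fo.
Proof.
split=> x y; first by case/orP=> [/pf_adj|/and3P[]].
move=> xy; rewrite /fo [adj y x]adj_sym xy.
case: (boolP (pf x y)) => p1 /=.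
  by rewrite (negbTE (pf_anti p1)).
case: (boolP (pf y x)) => p2 //=.
case: (ltngtP (enum_rank x) (enum_rank y)) => // /val_inj/enum_rank_inj e.
by rewrite e adj_irrefl in xy.
Qed.

Lemma spoke_colour x : x \notin D -> if c x then pf (dm x) x else pf x (dm x).
Proof.
move=> xD; have dD := dm_in domD x; case: (boolP (inl x \in X)) => xX.
  have := forallP okc x; rewrite xD xX => /eqP ->; have := used_spoke xD xX.
  by rewrite /pf; case: (p0 (dm x) x) => //= ->.
have nu : ~~ usedG x by rewrite /usedG negb_or xD.
case: ifP => cx; apply/orP; right; rewrite /q0 ?dD ?(negbTE xD) eqxx cx ?(negbTE nu) ?andbF /= ?andbT.
  by rewrite adj_sym dm_adj.
by rewrite dm_adj.
Qed.

(** The spoke settles one direction. The other uses a second neighbour: it lies in [D], or there is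
    a neighbour of opposite colour, whose spoke continues the walk. *)
Lemma leave_unused x : x \notin D -> inl x \notin X ->
  (exists2 d, d \in D & reach pf 2 x d) /\ (exists2 d, d \in D & reach pf 2 d x).
Proof.
move=> xD xX; have nu : ~~ usedG x by rewrite /usedG negb_or xD.
have dD := dm_in domD x; have sc := spoke_colour xD.
have [w xw wne] := other_nbr xD.
have wx := xw; rewrite adj_sym in wx.
case: (boolP (w \in D)) => wD.
  case cx : (c x) sc => sc.
    split; [exists w|exists (dm x)] => //; apply: reach1 => //.
    by apply/orP; right; rewrite /q0 xw (negbTE nu) (negbTE xD) wD (negbTE wne) cx.
  split; [exists (dm x)|exists w] => //; apply: reach1 => //.
  by apply/orP; right; rewrite /q0 wx (negbTE nu) andbF wD (negbTE wne) cx.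
have [z [xz zD cz]] := bestc xD xX (ex_intro2 _ _ w xw wD).
have zx := xz; rewrite adj_sym in zx.
have scz := spoke_colour zD; have zdD := dm_in domD z.
rewrite cz in scz; case cx : (c x) sc scz => /= sc scz; rewrite cx in cz.
  split; [exists (dm z)|exists (dm x)] => //; last exact: reach1.
  apply: (@reach_trans _ _ 1 1 z); apply: reach1 => //.
  by apply/orP; right; rewrite /q0 xz (negbTE nu) (negbTE xD) (negbTE zD) cx cz.
split; [exists (dm x)|exists (dm z)] => //; first exact: reach1.
apply: (@reach_trans _ _ 1 1 z); apply: reach1 => //.
by apply/orP; right; rewrite /q0 zx (negbTE nu) andbF (negbTE xD) (negbTE zD) cx cz.
Qed.

Lemma fo_reach x y : 0 < #|D| -> reach fo (uphalf (7 * #|D| + 1)) x y.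
Proof.
move=> D0.
have sp : subrel p0 fo by move=> u v h; rewrite /fo /pf h.
have sf : subrel pf fo by move=> u v h; rewrite /fo h.
have ext z : (exists d s, [/\ usedG d, reach fo s z d & 2 * s + wG d <= 5]) /\
             (exists d s, [/\ usedG d, reach fo s d z & 2 * s + wG d <= 5]).
  case: (boolP (usedG z)) => zu.
    have w4 : wG z <= 4 by rewrite /wG; case: ifP.
    by split; exists z, 0; split=> //; try exact: reach0; lia.
  move: zu; rewrite /usedG negb_or => /andP[zD zX].
  have [[d1 d1D r1] [d2 d2D r2]] := leave_unused zD zX.
  split; [exists d1, 2|exists d2, 2]; rewrite ?d1D ?d2D /wG; split=> //; try by rewrite ?d1D ?d2D.
  - exact: reach_sub r1.
  - exact: reach_sub r2.
(* A covered vertex counts with its own weight, at most 4; an uncovered one spends two arcs to a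
   vertex of [D] of weight 1. Thus twice the length is at most [5 + 5 + 7 * (#|D| - 1) - 1 = 7 *
   #|D| + 2], half of which rounds down to the bound. *)
have [[d [s [dU rd hd]]] _] := ext x; have [_ [d' [s' [dU' rd' hd']]]] := ext y.
have [m rm hm] := p0_dist dU dU'.
apply: reach_le (reach_trans rd (reach_trans (reach_sub sp rm) rd')).
by move: hd hd' hm D0; clear; lia.
Qed.

End WithColour.
End FinalOrientation.

Theorem oriented_diam_bound (G : sgraph) (D : {set G}) : connected_graph G -> bridgeless G ->
  dominating D -> exists2 d, is_oriented_diam G d & d <= uphalf (7 * #|D| + 1).
Proof.
move=> conG brl domD.
have D0 : 0 < #|D|.
  case: conG => /card_gt0P[x _] _; apply/card_gt0P; exists (dm D x); exact: dm_in.
have [X [o [t co]]] : exists X o t, @core (gI domD) setT X o t.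
  apply: (core_exists (leqnn _)); last by rewrite gN_card.
  exact: gI_ok.
have [c [okc bestc]] := best_colour X o.
apply: (oriented_diam_le (fo_orientation co c)) => x y.
by eapply fo_reach; eassumption.
Qed.

(** * The extremal chains *)

Section Bridgeless.
Variable G : sgraph.
Hypothesis conG : connected_graph G.

Lemma remove_edgeE (x y u v : G) : adj u v -> ~ (u = x /\ v = y) -> ~ (u = y /\ v = x) ->
  remove_edge x y u v.
Proof.
move=> uv h1 h2; rewrite /remove_edge /= uv !inE negb_or andTb.
by apply/andP; split; apply/negP => /eqP[e1 e2]; [apply: h1|apply: h2].
Qed.

Lemma cycle_not_bridge (x y : G) : adj x y -> connect (remove_edge x y) x y -> ~ bridge x y.
Proof.
move=> xy cxy [_]; apply; split; first by case: conG.
have sy : connect_sym (remove_edge x y).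
  apply: sym_connect_sym => u v; rewrite /remove_edge /= adj_sym !inE !xpair_eqE.
  by congr (_ && ~~ _); rewrite orbC andbC [X in _ || X]andbC.
move=> u v; have := (proj2 conG) u v; apply: connect_sub => {}u {}v uv.
case: (boolP ((u, v) \in [:: (x, y); (y, x)])) => h; last first.
  by apply: connect1; rewrite /remove_edge /= uv.
by move: h; rewrite !inE => /orP[] /eqP[-> ->] //; rewrite sy.
Qed.

Lemma triangle_not_bridge (x y z : G) : adj x y -> adj x z -> adj z y -> ~ bridge x y.
Proof.
move=> xy xz zy; apply: cycle_not_bridge => //.
apply: (@connect_trans _ _ z); apply: connect1; apply: remove_edgeE => // -[].
- by move=> _ e; rewrite e adj_irrefl in zy.
- by move=> e; rewrite e adj_irrefl in xy.
- by move=> e; rewrite e adj_irrefl in xz.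
- by move=> e; rewrite e adj_irrefl in zy.
Qed.

Lemma square_not_bridge (x y z w : G) : adj x y -> adj x z -> adj z w -> adj w y ->
  z != y -> w != x -> ~ bridge x y.
Proof.
move=> xy xz zw wy zny wnx; apply: cycle_not_bridge => //.
apply: (@connect_trans _ _ z); last apply: (@connect_trans _ _ w);
  apply: connect1; apply: remove_edgeE => // -[].
- by move=> _ e; rewrite e eqxx in zny.
- by move=> e; rewrite e adj_irrefl in xy.
- by move=> e; rewrite e adj_irrefl in xz.
- by move=> e; rewrite e eqxx in zny.
- by move=> e; rewrite e eqxx in wnx.
- by move=> e; rewrite e adj_irrefl in wy.
Qed.

(** The pair [x], [y] is linked to the rest through [k] only, so one arc from [k] must enter it and
    one must return: the triangle is cyclic at [k]. *)
Lemma pendant_triangle (o : rel G) (k x y : G) : orientation o -> strong o ->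
  k != x -> k != y -> adj k x -> adj k y ->
  (forall z, adj x z -> (z == k) || (z == y)) -> (forall z, adj y z -> (z == k) || (z == x)) ->
  o k x = o y k /\ o x k = o k y.
Proof.
move=> [osub oxor] st kx ky akx aky nx ny.
have con u v : connect o u v.
  by have [p /and3P[p1 /eqP p2 _]] := st u v; apply/connectP; exists p.
have kS : k \notin [set x; y] by rewrite !inE negb_or kx ky.
have xS : x \in [set x; y] by rewrite !inE eqxx.
have inn : o k x || o k y.
  have [u [v [uv uS vS]]] := cross_exists con kS xS.
  have auv := osub _ _ uv; rewrite adj_sym in auv.
  move: vS uS; rewrite !inE negb_or => /orP[] /eqP e /andP[ux uy]; rewrite {v}e in uv auv.
    by have := nx _ auv; rewrite (negbTE uy) orbF => /eqP <-; rewrite uv.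
  by have := ny _ auv; rewrite (negbTE ux) orbF => /eqP <-; rewrite uv orbT.
have out : o x k || o y k.
  have [||u [v [uv uS vS]]] := @cross_exists _ o (~: [set x; y]) x k con.
  - by rewrite inE negbK.
  - by rewrite inE.
  have auv := osub _ _ uv.
  move: uS vS; rewrite !inE negbK negb_or => /orP[] /eqP e /andP[vx vy]; rewrite {u}e in uv auv.
    by have := nx _ auv; rewrite (negbTE vy) orbF => /eqP <-; rewrite uv.
  by have := ny _ auv; rewrite (negbTE vx) orbF => /eqP <-; rewrite uv orbT.
have := oxor _ _ akx; have := oxor _ _ aky.
by case: (o k x) inn; case: (o k y); case: (o x k) out; case: (o y k).
Qed.

End Bridgeless.

(** Certifies lower bounds for distances without inspecting paths: only the arcs are checked. *)
Lemma potential_up (T : finType) (o : rel T) (phi : T -> nat) n x y :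
  (forall u v, o u v -> phi v <= phi u + 1) -> reach o n x y -> phi y <= phi x + n.
Proof.
move=> h [p [p1 <- p3]]; apply: (@leq_trans (phi x + size p)); last by rewrite leq_add2l.
elim: p x p1 {p3} => [|z p IH] x /=; first by rewrite addn0.
by case/andP=> /h xz /IH hz; lia.
Qed.

Lemma potential_down (T : finType) (o : rel T) (phi : T -> nat) n x y :
  (forall u v, o u v -> phi u <= phi v + 1) -> reach o n x y -> phi x <= phi y + n.
Proof.
move=> h [p [p1 <- p3]]; apply: (@leq_trans (phi (last x p) + size p)); last by rewrite leq_add2l.
elim: p x p1 {p3} => [|z p IH] x /=; first by rewrite addn0.
by case/andP=> /h xz /IH hz; lia.
Qed.

Section Chain.
Variable m : nat.
Local Notation K := 'I_m.+1.

(* [(i, 0)] is the [i]-th centre and [(i, 1)], [(i, 2)] form a triangle with it.  For [i < m] the vertices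
   [(i, 1)], [(i, 3)], [(i + 1, 0)], [(i, 4)] form a 4-cycle; the remaining [(m, 3)], [(m, 4)] form
   a triangle with the centre [(0, 0)]. *)
Definition chain_base (x y : K * 'I_5) : bool :=
  let: (i, s) := x in let: (j, t) := y in
  (i == j) && ((val s, val t) \in [:: (0, 1); (0, 2); (1, 2)])
  || (i == j) && ((i == m :> nat) && ((val s, val t) == (3, 4))
               || (i != m :> nat) && ((val s, val t) \in [:: (1, 3); (1, 4)]))
  || [&& j == ordS i, val t == 0 & val s \in [:: 3; 4]].

Definition chain_adj : rel (K * 'I_5) := [rel x y | chain_base x y || chain_base y x].

Lemma chain_sym : symmetric chain_adj.
Proof. by move=> x y; rewrite /chain_adj /= orbC. Qed.

Lemma chain_irr : irreflexive chain_adj.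
Proof.
move=> [i s]; rewrite /chain_adj /= orbb.
by case: s => [[|[|[|[|[|]]]]] hs] //=; rewrite ?andbF ?orbF //= ?andbF.
Qed.

Definition chain : sgraph := SGraph chain_sym chain_irr.

Definition vx (i : K) k (h : k < 5) : chain := (i, Ordinal h).
Local Notation c0 i := (@vx i 0 isT).
Local Notation c1 i := (@vx i 1 isT).
Local Notation c2 i := (@vx i 2 isT).
Local Notation c3 i := (@vx i 3 isT).
Local Notation c4 i := (@vx i 4 isT).

Lemma chain_ind (P : chain -> Prop) : (forall i, P (c0 i)) -> (forall i, P (c1 i)) ->
  (forall i, P (c2 i)) -> (forall i, P (c3 i)) -> (forall i, P (c4 i)) -> forall x, P x.
Proof.
move=> h0 h1 h2 h3 h4 [i [[|[|[|[|[|k]]]]] hs]] //.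
- by have := h0 i; rewrite /vx (_ : Ordinal _ = Ordinal hs) //; apply: val_inj.
- by have := h1 i; rewrite /vx (_ : Ordinal _ = Ordinal hs) //; apply: val_inj.
- by have := h2 i; rewrite /vx (_ : Ordinal _ = Ordinal hs) //; apply: val_inj.
- by have := h3 i; rewrite /vx (_ : Ordinal _ = Ordinal hs) //; apply: val_inj.
- by have := h4 i; rewrite /vx (_ : Ordinal _ = Ordinal hs) //; apply: val_inj.
Qed.

Inductive chain_edge : chain -> chain -> Prop :=
  | E01 i : chain_edge (c0 i) (c1 i)
  | E02 i : chain_edge (c0 i) (c2 i)
  | E12 i : chain_edge (c1 i) (c2 i)
  | E34 (i : K) of i = m :> nat : chain_edge (c3 i) (c4 i)
  | E13 (i : K) of i != m :> nat : chain_edge (c1 i) (c3 i)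
  | E14 (i : K) of i != m :> nat : chain_edge (c1 i) (c4 i)
  | E30 i : chain_edge (c3 i) (c0 (ordS i))
  | E40 i : chain_edge (c4 i) (c0 (ordS i)).

Lemma chain_baseP x y : reflect (chain_edge x y) (chain_base x y).
Proof.
apply: (iffP idP); last first.
  case=> [i|i|i|i|i|i|i|i]; rewrite /chain_base /= ?eqxx ?orbT //.
  - by move=> ->; rewrite !eqxx ?orbT.
  - by move=> ->; rewrite ?orbT.
  - by move=> ->; rewrite ?orbT.
elim/chain_ind: x => i; elim/chain_ind: y => j; rewrite /chain_base /= ?andbF ?orbF ?andbT //=.
- by move/eqP=> ->; constructor.
- by move/eqP=> ->; constructor.
- by move/eqP=> ->; constructor.
- by case/andP=> /eqP -> h; constructor.
- by case/andP=> /eqP -> h; constructor.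
- by move/eqP=> ->; constructor.
- by case/andP=> /eqP -> /eqP h; constructor.
- by move/eqP=> ->; constructor.
Qed.

Lemma chain_adjE (x y : chain) : adj x y = chain_base x y || chain_base y x.
Proof. by []. Qed.

Lemma chain_adjP x y : adj x y -> chain_edge x y \/ chain_edge y x.
Proof. by case/orP=> /chain_baseP; [left|right]. Qed.

Lemma edge_adj x y : chain_edge x y -> adj x y /\ adj y x.
Proof. by move/chain_baseP=> h; split; rewrite chain_adjE h ?orbT. Qed.

Lemma ordS_lt (i : K) : i != m :> nat -> ordS i = i.+1 :> nat.
Proof. by move=> im; have := ltn_ord i; rewrite /= => h; rewrite modn_small; lia. Qed.

Lemma ordS_last (i : K) : i = m :> nat -> ordS i = ord0.
Proof. by move=> im; apply: val_inj; rewrite /= im modnn. Qed.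

Lemma chain_connected : connected_graph chain.
Proof.
have sy : connect_sym (@adj chain) by apply: sym_connect_sym; apply: chain_sym.
have ed x y : chain_edge x y -> connect (@adj chain) x y.
  by case/edge_adj=> h _; apply: connect1.
have cc k (h : k < m.+1) : connect (@adj chain) (c0 (Ordinal h)) (c0 ord0).
  elim: k h => [|k IH] h; first by rewrite (_ : Ordinal h = ord0) //; apply: val_inj.
  pose i : K := Ordinal (ltnW h); have im : i != m :> nat by rewrite /=; lia.
  have -> : Ordinal h = ordS i by apply: ord_inj; rewrite ordS_lt.
  apply: connect_trans (IH (ltnW h)); rewrite sy.
  apply: connect_trans (ed _ _ (E01 i)) _; apply: connect_trans (ed _ _ (E13 im)) _.
  exact: ed (E30 i).
have all0 x : connect (@adj chain) x (c0 ord0).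
  have ci i : connect (@adj chain) (c0 i) (c0 ord0) by case: i => k h; apply: cc.
  elim/chain_ind: x => i //.
  - by rewrite sy; apply: connect_trans _ (ed _ _ (E01 i)); rewrite sy.
  - by rewrite sy; apply: connect_trans _ (ed _ _ (E02 i)); rewrite sy.
  - exact: connect_trans (ed _ _ (E30 i)) (ci _).
  - exact: connect_trans (ed _ _ (E40 i)) (ci _).
split; first by apply/card_gt0P; exists (c0 ord0).
by move=> x y; apply: connect_trans (all0 x) _; rewrite sy.
Qed.

Lemma chain_bridgeless : bridgeless chain.
Proof.
move=> x y br; have [xy _] := br.
have tri x' y' z : chain_edge x' y' -> adj x' z -> adj z y' -> ~ bridge x' y' /\ ~ bridge y' x'.
  case/edge_adj=> h1 h2 h3 h4; split.
    exact: (triangle_not_bridge chain_connected h1 h3 h4).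
  by apply: (triangle_not_bridge chain_connected h2 (z := z)); rewrite adj_sym.
have squ x' y' z w : chain_edge x' y' -> adj x' z -> adj z w -> adj w y' -> z != y' -> w != x' ->
    ~ bridge x' y' /\ ~ bridge y' x'.
  case/edge_adj=> h1 h2 h3 h4 h5 h6 h7; split.
    exact: (square_not_bridge chain_connected h1 h3 h4 h5 h6 h7).
  by apply: (square_not_bridge chain_connected h2 (z := w) (w := z)); rewrite // adj_sym.
have ed1 x' y' : chain_edge x' y' -> adj x' y' by case/edge_adj.
have ed2 x' y' : chain_edge x' y' -> adj y' x' by case/edge_adj.
have all_edges x' y' : chain_edge x' y' -> ~ bridge x' y' /\ ~ bridge y' x'.
  case=> [i|i|i|i im|i im|i im|i|i].
  - by apply: (tri _ _ (c2 i)); [exact: E01|exact/ed1/E02|exact/ed2/E12].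
  - by apply: (tri _ _ (c1 i)); [exact: E02|exact/ed1/E01|exact/ed1/E12].
  - by apply: (tri _ _ (c0 i)); [exact: E12|exact/ed2/E01|exact/ed1/E02].
  - by apply: (tri _ _ (c0 (ordS i))); [exact: E34|exact/ed1/E30|exact/ed2/E40].
  - by apply: (squ _ _ (c4 i) (c0 (ordS i))); [exact: E13|exact/ed1/E14|exact/ed1/E40|exact/ed2/E30|rewrite
    xpair_eqE andbF|rewrite xpair_eqE andbF].
  - by apply: (squ _ _ (c3 i) (c0 (ordS i))); [exact: E14|exact/ed1/E13|exact/ed1/E30|exact/ed2/E40|rewrite
    xpair_eqE andbF|rewrite xpair_eqE andbF].
  - have [im|im] := eqVneq (i : nat) m.
      by apply: (tri _ _ (c4 i)); [exact: E30|exact/ed1/E34|exact/ed1/E40].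
    by apply: (squ _ _ (c1 i) (c4 i)); [exact: E30|exact/ed2/E13|exact/ed1/E14|exact/ed1/E40|rewrite
      xpair_eqE andbF|rewrite xpair_eqE andbF].
  - have [im|im] := eqVneq (i : nat) m.
      by apply: (tri _ _ (c3 i)); [exact: E40|exact/ed2/E34|exact/ed1/E30].
    by apply: (squ _ _ (c1 i) (c3 i)); [exact: E40|exact/ed2/E14|exact/ed1/E13|exact/ed1/E30|rewrite
      xpair_eqE andbF|rewrite xpair_eqE andbF].
by case: (chain_adjP xy) => /all_edges[].
Qed.

Definition centres : {set chain} := [set c0 i | i : K].

Lemma centres_card : #|centres| = m.+1.
Proof. by rewrite card_imset ?card_ord // => i j []. Qed.

Lemma centres_dominating : dominating centres.
Proof.
have cin i : c0 i \in centres by apply: imset_f.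
apply/forallP => x; apply/implyP => xD; apply/existsP.
elim/chain_ind: x xD => i xD; first by rewrite cin in xD.
- by exists (c0 i); rewrite cin; have [_ ->] := edge_adj (E01 i).
- by exists (c0 i); rewrite cin; have [_ ->] := edge_adj (E02 i).
- by exists (c0 (ordS i)); rewrite cin; have [-> _] := edge_adj (E30 i).
- by exists (c0 (ordS i)); rewrite cin; have [-> _] := edge_adj (E40 i).
Qed.

Ltac nbrs := rewrite chain_adjE /chain_base /= ?eqxx ?andbF ?orbF ?andbT //= ?eqxx ?andbF ?orbF ?andbT
  ?orbT //=.

Lemma nbr_c2 i x : adj (c2 i) x -> (x == c0 i) || (x == c1 i).
Proof. by elim/chain_ind: x => j; nbrs; move/eqP=> ->; rewrite eqxx ?orbT. Qed.

Lemma nbr_c1 x : adj (c1 (ord_max : K)) x -> (x == c0 ord_max) || (x == c2 ord_max).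
Proof. by elim/chain_ind: x => j; nbrs; move/eqP=> ->; rewrite eqxx ?orbT. Qed.

Lemma nbr_c3 x : adj (c3 (ord_max : K)) x -> (x == c0 ord0) || (x == c4 ord_max).
Proof.
rewrite -(ordS_last (erefl : ord_max = m :> nat)).
by elim/chain_ind: x => j; nbrs; first [by move/eqP=> ->; rewrite eqxx ?orbT
  | by case/andP=> /eqP ->; rewrite /= eqxx | by case/andP=> /eqP -> _; rewrite eqxx ?orbT].
Qed.

Lemma nbr_c4 x : adj (c4 (ord_max : K)) x -> (x == c0 ord0) || (x == c3 ord_max).
Proof.
rewrite -(ordS_last (erefl : ord_max = m :> nat)).
by elim/chain_ind: x => j; nbrs; first [by move/eqP=> ->; rewrite eqxx ?orbT
  | by case/andP=> /eqP ->; rewrite /= eqxx | by case/andP=> /eqP -> _; rewrite eqxx ?orbT].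
Qed.

(** The closed neighbourhood of [c2 i] stays in the [i]-th group of five vertices, so a dominating
    set meets every group. *)
Lemma chain_domination : domination_number chain = m.+1.
Proof.
rewrite /domination_number; case: arg_minnP.
  by apply/forallP => x; rewrite in_setT.
move=> D domD Dmin; apply/eqP; rewrite eqn_leq; apply/andP; split.
  by rewrite -centres_card; apply: Dmin; apply: centres_dominating.
apply: leq_trans (leq_imset_card fst D).
rewrite -[X in X <= _]card_ord; apply: subset_leq_card; apply/subsetP => i _.
have := forallP domD (c2 i); case: (boolP (c2 i \in D)) => [iD _|_ /existsP[d /andP[dD /nbr_c2]]].
  by apply/imsetP; exists (c2 i).
by case/orP=> /eqP e; apply/imsetP; exists d; rewrite // e.
Qed.

(** * Lower bound for the oriented diameter of the chain *)

Section LowerBound.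
Variable o : rel chain.
Hypotheses (oo : orientation o) (st : strong o).

Definition ff (i : K) : nat := if o (c1 i) (c0 i) then 2 else 1.
(** From one centre to the next, [ff] counts the triangle and 2 the 4-cycle. Backwards the triangle
    costs at least 3 less [ff], so [BB] has steps of 5 less [ff], and each link contributes 7 in
    total. *)
Definition FF k := \sum_(0 <= j < k) (2 + ff (inord j)).
Definition BB k := \sum_(0 <= j < k) (5 - ff (inord j)).
Definition ee : bool := o (c3 ord_max) (c0 ord0).

(* Lower bounds for the distances to the right and to the left end; [ff i] is the length of the directed
   path from [(i, 0)] to [(i, 1)] in their triangle. *)
Definition phi (x : chain) : nat := let: (i, s) := x in
  match val s with
  | 0 => 2 + FF i
  | 1 => 2 + FF i + ff i
  | 2 => if i == m :> nat then 5 + FF i - ff i else 3 + FF i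
  | 3 => if i == m :> nat then ee : nat else 3 + FF i + ff i
  | _ => if i == m :> nat then ~~ ee : nat else 3 + FF i + ff i
  end.
Definition psi (x : chain) : nat := let: (i, s) := x in
  match val s with
  | 0 => 2 + BB i
  | 1 => 5 + BB i - ff i
  | 2 => if i == m :> nat then 2 + BB i + ff i else 3 + BB i
  | 3 => if i == m :> nat then ~~ ee : nat else 6 + BB i - ff i
  | _ => if i == m :> nat then ee : nat else 6 + BB i - ff i
  end.

Lemma ff_cases i : ff i = 1 \/ ff i = 2.
Proof. by rewrite /ff; case: ifP; [right|left]. Qed.

Lemma FF_S (i : K) : i != m :> nat -> FF (ordS i) = FF i + 2 + ff i.
Proof. by move=> im; rewrite ordS_lt // /FF big_nat_recr //= inord_val addnA. Qed.

Lemma BB_S (i : K) : i != m :> nat -> BB (ordS i) = BB i + (5 - ff i).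
Proof. by move=> im; rewrite ordS_lt // /BB big_nat_recr //= inord_val. Qed.

Lemma FB_sum k : FF k + BB k = 7 * k.
Proof.
rewrite /FF /BB -big_split /= (eq_bigr (fun=> 7)) => [|j _].
  by rewrite sum_nat_const_nat subn0 mulnC.
by have [->|->] := ff_cases (inord j).
Qed.

Lemma oxor x y : chain_edge x y -> o x y = ~~ o y x.
Proof. by case/edge_adj=> /(proj2 oo); case: (o x y); case: (o y x). Qed.

Lemma arc_bounds x y : chain_edge x y ->
  (o x y -> phi y <= phi x + 1 /\ psi x <= psi y + 1) /\
  (o y x -> phi x <= phi y + 1 /\ psi y <= psi x + 1).
Proof.
(* Only the end triangles are pendant and thus forced to be cyclic; this justifies the special
   values of the potentials at [i = m]. *)
have [P1 P2] : o (c0 ord_max) (c1 ord_max) = o (c2 ord_max) (c0 ord_max) /\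
               o (c1 ord_max) (c0 ord_max) = o (c0 ord_max) (c2 ord_max).
  apply: (pendant_triangle oo st) => //; try (by rewrite xpair_eqE andbF).
  - by case: (edge_adj (E01 (ord_max : K))).
  - by case: (edge_adj (E02 (ord_max : K))).
  - exact: nbr_c1.
  - exact: nbr_c2.
have [Q1 Q2] : o (c0 ord0) (c3 ord_max) = o (c4 ord_max) (c0 ord0) /\
               o (c3 ord_max) (c0 ord0) = o (c0 ord0) (c4 ord_max).
  have e0 : ord0 = ordS (ord_max : K) by rewrite ordS_last.
  apply: (pendant_triangle oo st) => //; try (by rewrite xpair_eqE andbF).
  - by rewrite e0; case: (edge_adj (E30 (ord_max : K))).
  - by rewrite e0; case: (edge_adj (E40 (ord_max : K))).
  - exact: nbr_c3.
  - exact: nbr_c4.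
have imax (i : K) : i = m :> nat -> i = ord_max by move=> im; apply: val_inj.
have phi0 i : phi (c0 i) = 2 + FF i by [].
have psi0 i : psi (c0 i) = 2 + BB i by [].
have F0 : FF (ord0 : K) = 0 by rewrite /FF big_nil.
have B0 : BB (ord0 : K) = 0 by rewrite /BB big_nil.
have X01 := oxor (E01 (ord_max : K)).
have X30 := oxor (E30 (ord_max : K)); rewrite ordS_last // in X30.
case=> [i|i|i|i im|i im|i im|i|i].
- have X := oxor (E01 i); rewrite /phi /psi /= /ff X.
  by case: (o (c1 i) (c0 i)) => //=; split=> // _; clear; lia.
- rewrite /phi /psi /=; case: eqP => im; last by clear; split=> _; lia.
  have e := imax _ im; subst i; rewrite -P1 -P2 X01 /ff.
  by case: (o (c1 ord_max) (c0 ord_max)) => //=; split=> // _; clear; lia.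
- rewrite /phi /psi /=; have := ff_cases i; clear; case: eqP => _ [] ->; by split=> _; lia.
- rewrite /phi /psi /= im eqxx; by clear; case: ee; split=> _.
- rewrite /phi /psi /= (negbTE im); have := ff_cases i; clear; case=> ->; by split=> _; lia.
- rewrite /phi /psi /= (negbTE im); have := ff_cases i; clear; case=> ->; by split=> _; lia.
- have [im|im] := eqVneq (i : nat) m; last first.
    have -> : phi (c3 i) = 3 + FF i + ff i by rewrite /phi /= (negbTE im).
    have -> : psi (c3 i) = 6 + BB i - ff i by rewrite /psi /= (negbTE im).
    rewrite phi0 psi0 FF_S // BB_S //; have := ff_cases i; clear; case=> ->; by split=> _; lia.
  have e := imax _ im; subst i; rewrite ordS_last //.
  have -> : phi (c3 ord_max) = ee by rewrite /phi /= eqxx.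
  have -> : psi (c3 ord_max) = ~~ ee by rewrite /psi /= eqxx.
  by rewrite phi0 psi0 F0 B0 /ee X30; case: (o (c0 ord0) (c3 ord_max)); split=> // _; split.
- have [im|im] := eqVneq (i : nat) m; last first.
    have -> : phi (c4 i) = 3 + FF i + ff i by rewrite /phi /= (negbTE im).
    have -> : psi (c4 i) = 6 + BB i - ff i by rewrite /psi /= (negbTE im).
    rewrite phi0 psi0 FF_S // BB_S //; have := ff_cases i; clear; case=> ->; by split=> _; lia.
  have e := imax _ im; subst i; rewrite ordS_last //.
  have -> : phi (c4 ord_max) = ~~ ee by rewrite /phi /= eqxx.
  have -> : psi (c4 ord_max) = ee by rewrite /psi /= eqxx.
  by rewrite phi0 psi0 F0 B0 -Q1 -Q2 /ee X30; case: (o (c0 ord0) (c3 ord_max)); split=> // _; split.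
Qed.

Lemma phi_arc u v : o u v -> phi v <= phi u + 1.
Proof. by move=> uv; case: (chain_adjP (proj1 oo _ _ uv)) => /arc_bounds[h1 h2];
  [case: (h1 uv)|case: (h2 uv)]. Qed.

Lemma psi_arc u v : o u v -> psi u <= psi v + 1.
Proof. by move=> uv; case: (chain_adjP (proj1 oo _ _ uv)) => /arc_bounds[h1 h2];
  [case: (h1 uv)|case: (h2 uv)]. Qed.

Lemma chain_diam_ge : uphalf (7 * m.+1 + 1) <= diam o.
Proof.
have dp x y p : dpath o x y p -> reach o (size p) x y.
  by case/and3P=> h1 /eqP h2 _; exists p.
(* In each cyclic end triangle one vertex is two arcs before the centre and the other two arcs after
   it. Starting at the former and ending at the latter adds 4 in either direction, so both distances
   sum to at least [7 * m + 8 = 7 * m.+1 + 1]. *)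
pose s0 : chain := if ee then c4 ord_max else c3 ord_max.
pose r0 : chain := if ee then c3 ord_max else c4 ord_max.
pose r1 : chain := if o (c1 ord_max) (c0 ord_max) then c1 ord_max else c2 ord_max.
pose s1 : chain := if o (c1 ord_max) (c0 ord_max) then c2 ord_max else c1 ord_max.
have a1 : phi s0 = 0 by rewrite /s0; case E : ee; rewrite /phi /= eqxx E.
have a2 : psi r0 = 0 by rewrite /r0; case E : ee; rewrite /psi /= eqxx E.
have a3 : phi r1 = 4 + FF m.
  by rewrite /r1; case E : (o _ _); rewrite /phi /= ?eqxx /ff E; clear; lia.
have a4 : psi s1 = 4 + BB m.
  by rewrite /s1; case E : (o _ _); rewrite /psi /= ?eqxx /ff E; clear; lia.
have d1 : 4 + FF m <= dist o s0 r1.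
  apply: dist_ge => [|p /dp pr]; first exact: st.
  by have := potential_up phi_arc pr; rewrite a1 a3.
have d2 : 4 + BB m <= dist o s1 r0.
  apply: dist_ge => [|p /dp pr]; first exact: st.
  by have := potential_down psi_arc pr; rewrite a2 a4.
have := dist_diam o s0 r1; have := dist_diam o s1 r0; have := FB_sum m.
by move: d1 d2; clear; lia.
Qed.

End LowerBound.

(** The general upper bound, applied to the centres, provides the optimal orientation, so none has
    to be exhibited for the chain. *)
Lemma chain_oriented_diam : is_oriented_diam chain (uphalf (7 * m.+1 + 1)).
Proof.
have [d [[o [oo st dE]] dmin] dle] := oriented_diam_bound chain_connected chain_bridgeless centres_dominating.
rewrite centres_card in dle.
have dge : uphalf (7 * m.+1 + 1) <= d by rewrite -dE; apply: chain_diam_ge.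
have -> : uphalf (7 * m.+1 + 1) = d by apply/eqP; rewrite eqn_leq dge dle.
by split=> //; exists o.
Qed.

End Chain.

(* [uphalf n] is the ceiling of n / 2. *)
Theorem theorem1p8 :
  (forall (G : sgraph) (D : {set G}) (gamma : nat),
     connected_graph G -> bridgeless G -> dominating D -> #|D| = gamma ->
     exists2 d : nat, is_oriented_diam G d & d <= uphalf (7 * gamma + 1)) /\
  (forall gamma : nat, 0 < gamma ->
     exists G : sgraph,
       [/\ connected_graph G, bridgeless G, domination_number G = gamma
         & is_oriented_diam G (uphalf (7 * gamma + 1))]).
Proof.
split=> [G D gamma conG brl domD <-|[|m] // _]; first exact: oriented_diam_bound.
exists (chain m); split.
- exact: chain_connected.
- exact: chain_bridgeless.
- exact: chain_domination.
- exact: chain_oriented_diam.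
Qed.
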